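(* Let $\Omega\subset\mathbb{R}^d$ be a bounded open set, let $\{\delta_k\}$ be a decreasing sequence with $\delta_k\to0$ and $\delta_k\le\delta_0$, and let $D=\Omega\cup\{\mathbf{y}\in\mathbb{R}^d\setminus\Omega:\operatorname{dist}(\mathbf{y},\partial\Omega)<\delta_0\}$. Let the kernels $\gamma_{\delta_k}$, the polytopes, $\underline{r}(n_{\delta_k})$ and $\gamma_{\delta_k,n_{\delta_k}}$ be as in the context, and assume $$\lim_{k\to\infty}\int_{\|\mathbf{z}\|_2\le\underline{r}(n_{\delta_k})}z_i^2\,\widetilde{\gamma}_{\delta_k}(\|\mathbf{z}\|_2)\,d\mathbf{z}=1,\qquad i=1,\dots,d.$$ Let $u\in H^1(D)$ be the extension by zero of a function in $H^1_0(\Omega)$. Then $$\lim_{k\to\infty}\int_D\int_D|u(\mathbf{y})-u(\mathbf{x})|^2\,\gamma_{\delta_k,n_{\delta_k}}(\mathbf{x},\mathbf{y})\,d\mathbf{y}\,d\mathbf{x}=\int_D|\nabla u(\mathbf{x})|^2\,d\mathbf{x},$$ i.e. $\lim_{k\to\infty}\|u\|_{\delta_k,n_{\delta_k}}^2=\int_D|\nabla u|^2\,d\mathbf{x}$.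
   Context: $B_\delta(\mathbf{x})=\{\mathbf{y}\in\mathbb{R}^d:\|\mathbf{y}-\mathbf{x}\|_2\le\delta\}$. Each kernel is $\gamma_\delta(\mathbf{x},\mathbf{y})=\widetilde{\gamma}_\delta(\|\mathbf{y}-\mathbf{x}\|_2)$ with $\widetilde{\gamma}_\delta\ge0$, $\widetilde{\gamma}_\delta(t)>0$ for $0\le t<\delta$, $\widetilde{\gamma}_\delta(t)=0$ for $t>\delta$, and $\int_{B_\delta(\mathbf{0})}z_i^2\widetilde{\gamma}_\delta(\|\mathbf{z}\|_2)d\mathbf{z}=1$ for $i=1,\dots,d$. For each $\delta$ and each point $\mathbf{x}$ a polytope $B_{\delta,n_{\delta,\mathbf{x}}}(\mathbf{x})\subset B_\delta(\mathbf{x})$ is given; $r_{\delta,\mathbf{x}}$ is the radius of the largest ball centered at $\mathbf{x}$ contained in it and $\underline{r}(n_\delta)=\inf_{\mathbf{x}\in\Omega}r_{\delta,\mathbf{x}}$. $\gamma_{\delta,n_{\delta,\mathbf{x}}}(\mathbf{x},\mathbf{y})=\gamma_\delta(\mathbf{x},\mathbf{y})$ if $\mathbf{y}\in B_{\delta,n_{\delta,\mathbf{x}}}(\mathbf{x})$ and $0$ otherwise; $\gamma_{\delta,n_\delta}(\mathbf{x},\mathbf{y})=\tfrac12(\gamma_{\delta,n_{\delta,\mathbf{x}}}(\mathbf{x},\mathbf{y})+\gamma_{\delta,n_{\delta,\mathbf{y}}}(\mathbf{y},\mathbf{x}))$. *)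

(* Defs.v *)
From HB Require Import structures.
From mathcomp Require Import all_boot all_order all_algebra.
From mathcomp Require Import all_classical all_reals all_analysis.
Set Implicit Arguments. Unset Strict Implicit. Unset Printing Implicit Defensive.
Import Order.TTheory GRing.Theory Num.Theory.
Import numFieldNormedType.Exports.
Local Open Scope classical_set_scope.
Local Open Scope ring_scope.

Section Defs.
Variables (R : realType) (d : nat).
Notation V := 'rV[R]_d.

Definition norm2 (x : V) : R := Num.sqrt (\sum_(i < d) (x ord0 i) ^+ 2).

Definition cball2 (x : V) (r : R) : set V := [set y | norm2 (y - x) <= r].

Definition setc (x : V) (i : 'I_d) (t : R) : V :=
  \row_j (if j == i then t else x ord0 j).

(* Lebesgue integral over R^d of a nonnegative function, computed as the
   iterated one-dimensional Lebesgue integral (Tonelli). *)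
Fixpoint iint (s : seq 'I_d) (f : V -> \bar R) (x : V) : \bar R :=
  match s with
  | [::] => f x
  | i :: s' => (\int[lebesgue_measure]_t iint s' f (setc x i t))%E
  end.
Definition intRd (f : V -> \bar R) : \bar R := iint (enum 'I_d) f 0.

Definition intOn (A : set V) (f : V -> \bar R) : \bar R :=
  intRd (fun x => if `[< A x >] then f x else 0%E).

Definition borelRd : set (set V) := <<s [set A : set V | open A] >>.
Definition borel_fun (f : V -> R) : Prop :=
  forall a : R, borelRd (f @^-1` [set r | r < a]).

Definition evec (i : 'I_d) : V := delta_mx ord0 i.
Definition pderiv (i : 'I_d) (f : V -> R) : V -> R := fun x => 'D_(evec i) f x.
Definition pderivs (s : seq 'I_d) (f : V -> R) : V -> R := foldr pderiv f s.
Definition grad (f : V -> R) (x : V) : V := \row_i pderiv i f x.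

Definition smooth (f : V -> R) : Prop :=
  forall (s : seq 'I_d) (x : V), differentiable (pderivs s f) x.

Definition Cc_infty (Om : set V) (f : V -> R) : Prop :=
  smooth f /\ exists K : set V, [/\ compact K, K `<=` Om & forall x, ~ K x -> f x = 0].

(* u belongs to H^1_0(Om) with (weak) gradient g : the pair (u, g) is the
   H^1(Om)-limit of (phi_n, grad phi_n) for a sequence phi_n in C_c^infinity(Om). *)
Definition H10 (Om : set V) (u : V -> R) (g : V -> V) : Prop :=
  exists phi : nat -> V -> R,
    (forall n, Cc_infty Om (phi n)) /\
    ((fun n => intOn Om (fun x => ((phi n x - u x) ^+ 2)%:E)) @ \oo --> 0%E) /\
    ((fun n => intOn Om (fun x => ((norm2 (grad (phi n) x - g x)) ^+ 2)%:E)) @ \oo --> 0%E).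

Definition bdry (A : set V) : set V := closure A `\` interior A.
Definition dist2 (y : V) (A : set V) : R := inf [set norm2 (y - b) | b in A].

Definition inradius (P : set V) (x : V) : R :=
  sup [set r : R | 0 <= r /\ cball2 x r `<=` P].

Definition polytope (P : set V) : Prop :=
  exists (m : nat) (p : 'I_m -> V),
    P = [set y | exists w : 'I_m -> R,
           [/\ forall j, 0 <= w j, \sum_j w j = 1 & y = \sum_j w j *: p j]].

Definition gamma_trunc (gt : R -> R) (P : V -> set V) (x y : V) : R :=
  if `[< P x y >] then gt (norm2 (y - x)) else 0.
Definition gamma_sym (gt : R -> R) (P : V -> set V) (x y : V) : R :=
  (gamma_trunc gt P x y + gamma_trunc gt P y x) / 2.

End Defs.

(* Main.v *)
Require Import Defs.
From HB Require Import structures.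
From mathcomp Require Import all_boot all_order all_algebra.
From mathcomp Require Import all_classical all_reals all_analysis.
From mathcomp Require Import ring lra measurable_realfun.
Set Implicit Arguments. Unset Strict Implicit. Unset Printing Implicit Defensive.
Import Order.TTheory GRing.Theory Num.Theory.
Import numFieldNormedType.Exports.
Local Open Scope classical_set_scope.
Local Open Scope ring_scope.

(** The nonlocal energy is squeezed between two bounds.

    Upper bound: the truncated symmetrized kernel is at most the radial kernel
    gamma, and for every z the squared L^2 norm of u(. + z) - u is at most the
    integral of (grad u . z)^2 (for test functions by Taylor expansion at small
    steps, then by density).
    Integrating against gamma and exchanging the integrals gives at most the
    Dirichlet energy, because a radial kernel has vanishing mixed second moments
    and unit second moments.

    Lower bound: on Om x Om the kernel dominates gamma restricted to the ball of
    radius inf_x r_x.  For a test function phi close to u, Taylor expansion turns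
    the energy with this restricted kernel into that of grad phi weighted by the
    second moments, which tend to 1; the error u - phi is controlled uniformly in
    k by the upper bound, and no energy is lost near the boundary because phi has
    compact support in Om. *)

(** Integrals of nonnegative functions may a priori be infinite, so integrals are never subtracted:
    every perturbation goes through [a^2 <= (1 + e) b^2 + (1 + 1/e) (a - b)^2]. The weight [1 + 1/e]
    fixes the scales: test functions are taken within [e^2] of [u] in squared norm and Taylor
    remainders within [e |z|], so that every error is O(e). The upper bound serves the error
    [phi - u] because it rests on an estimate for each step [z] separately, hence covers every
    radial kernel with unit second moments; the errors in the lower bound are therefore measured
    with the full kernel, and only the main term carries the truncated one. The integral over R^d is
    given in iterated form; composing kernels, one coordinate at a time, produces an s-finite
    measure with the same integrals, for which Fubini and the invariance under translations and
    reflections can be proved. *)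

(** * The Borel sigma-algebra of R^d *)

(* Declared so that [measurable] on row vectors unfolds to [borelRd]. *)
HB.instance Definition _ (R : realType) (d : nat) :=
  @isMeasurable.Build (sigma_display (@open 'rV[R]_d)) 'rV[R]_d
  <<s @open 'rV[R]_d >> (@sigma_algebra0 _ setT _) (@sigma_algebraC _ _)
  (@sigma_algebra_bigcup _ setT _).

Section borel_row_vectors.
Variables (R : realType) (d : nat).
Notation V := 'rV[R]_d.

Lemma open_measurable_rV (A : set V) : open A -> measurable A.
Proof. exact: sub_sigma_algebra. Qed.

Lemma borel_fun_measurable (f : V -> R) : borel_fun f -> measurable_fun setT f.
Proof.
move=> bf; apply: (measurability _ (RGenInftyO.measurableE R)).
move=> _ [_ [a ->] <-]; rewrite setTI.
by rewrite [X in measurable X](_ : _ = f @^-1` [set r | r < a]);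
  [exact: bf|apply/seteqP; split=> x /=; rewrite in_itv].
Qed.

Lemma continuous_measurable_rV (f : V -> R) :
  continuous f -> measurable_fun setT f.
Proof.
move=> /continuousP cf; apply: borel_fun_measurable => a.
by apply: sub_sigma_algebra; apply: cf; exact: open_lt.
Qed.

Lemma measurable_coord (j : 'I_d) : measurable_fun setT (fun x : V => x ord0 j).
Proof. apply: continuous_measurable_rV => x; exact: coord_continuous. Qed.

Lemma rat_approx (x : R) (e : R) : 0 < e -> exists q : rat, `|x - ratr q| < e.
Proof.
move=> e0; have /rat_in_itvoo[q] : x - e < x + e by lra.
by rewrite in_itv /= => qi; exists q; rewrite ltr_norml; lra.
Qed.

Lemma rV_ball_coord (x y : V) (e : R) : 0 < e ->
  ball x e y <-> forall j, `|x ord0 j - y ord0 j| < e.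
Proof.
move=> e0; split=> [[_ h] j|h]; first exact: h.
by split=> // i j; rewrite ord1; exact: h.
Qed.

(** Countability of the index set is the point: it reduces Borel measurability of a vector-valued
    map to balls, which are cubes here and hence finite intersections of conditions on
    coordinates. *)
Lemma open_rat_bigcup (A : set V) : open A ->
  A = \bigcup_(p in [set p : 'rV[rat]_d * nat |
         ball (map_mx ratr p.1 : V) p.2.+1%:R^-1 `<=` A])
       ball (map_mx ratr p.1 : V) p.2.+1%:R^-1.
Proof.
move=> oA; apply/seteqP; split=> [x Ax|x [p /= pA /pA]//].
have [e /= e0 eA] := (nbhs_ballP _ _).1 (oA x Ax).
(* The rational centre is within [1/(n+1)] of [x], so its ball of that radius stays within twice
   this distance of [x], below [e]. *)
have [n] : exists n : nat, n.+1%:R^-1 < e / 2.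
  have e20 : 0 < e / 2 by rewrite divr_gt0.
  by have [n _ /(_ n (leqnn n))] := near_infty_natSinv_lt (PosNum e20); exists n.
move=> ne; have n0 : (0 : R) < n.+1%:R^-1 by rewrite invr_gt0.
have [q qP] : exists q : 'I_d -> rat, forall j, `|x ord0 j - ratr (q j)| < n.+1%:R^-1.
  exists (fun j => projT1 (cid (rat_approx (x ord0 j) n0))) => j.
  exact: (projT2 (cid (rat_approx (x ord0 j) n0))).
exists (\row_j q j, n) => /=; last first.
  by apply/rV_ball_coord => // j; rewrite !mxE distrC.
move=> y /(rV_ball_coord _ _ n0) h; apply: eA; apply/rV_ball_coord => // j.
have := h j; rewrite !mxE; have := qP j; move: ne.
rewrite !ltr_norml; set a := x ord0 j; set b := y ord0 j; set c := ratr _.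
set k := n.+1%:R^-1; lra.
Qed.

Lemma measurable_fun_rV d' (T : measurableType d') (f : T -> V) :
  (forall j, measurable_fun setT (fun t => f t ord0 j)) -> measurable_fun setT f.
Proof.
move=> mf; apply: (@measurability _ _ _ _ setT f (@open V)) => //.
move=> _ [A oA <-]; rewrite setTI (open_rat_bigcup oA) preimage_bigcup.
rewrite bigcup_mkcond; apply: countable_bigcupT_measurable => [|p].
  exact: countableP.
case: ifPn => // _.
rewrite [X in measurable X](_ : _ = \bigcap_(j in [set: 'I_d])
   ((fun t => f t ord0 j) @^-1` ball (ratr (p.1 ord0 j) : R) p.2.+1%:R^-1)).
  apply: fin_bigcap_measurable => // j _; rewrite -[X in measurable X]setTI.
  by apply: mf => //; exact: measurable_ball.
apply/seteqP; split=> t /=.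
  move=> /rV_ball_coord h j _ /=; have := h _ j; rewrite !mxE; apply.
  by rewrite invr_gt0.
move=> h; apply/rV_ball_coord => [|j]; first by rewrite invr_gt0.
by rewrite !mxE; exact: (h j).
Qed.

Lemma measurable_setc (i : 'I_d) :
  measurable_fun setT (fun p : V * R => setc p.1 i p.2).
Proof.
apply: measurable_fun_rV => j.
rewrite (_ : (fun _ => _) = fun p : V * R => if j == i then p.2 else p.1 ord0 j).
  by case: eqP => _; [exact: measurable_snd
    |exact: measurableT_comp (measurable_coord j) measurable_fst].
by apply/funext => p; rewrite mxE.
Qed.

Lemma measurable_rVD d' (T : measurableType d') (f g : T -> V) :
  measurable_fun setT f -> measurable_fun setT g ->
  measurable_fun setT (fun t => f t + g t).
Proof.
move=> mf mg; apply: measurable_fun_rV => j.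
rewrite (_ : (fun _ => _) = fun t => f t ord0 j + g t ord0 j); last first.
  by apply/funext => t; rewrite mxE.
by apply: measurable_funD; exact: measurableT_comp (measurable_coord j) _.
Qed.

Lemma measurable_rVB d' (T : measurableType d') (f g : T -> V) :
  measurable_fun setT f -> measurable_fun setT g ->
  measurable_fun setT (fun t => f t - g t).
Proof.
move=> mf mg; apply: measurable_fun_rV => j.
rewrite (_ : (fun _ => _) = fun t => f t ord0 j - g t ord0 j); last first.
  by apply/funext => t; rewrite !mxE.
by apply: measurable_funB; exact: measurableT_comp (measurable_coord j) _.
Qed.

Lemma measurable_fun_norm2 : measurable_fun setT (@norm2 R d).
Proof.
apply: measurableT_comp; first exact: (continuous_measurable_fun (@sqrt_continuous R)).
by apply: measurable_sum => i; apply: measurable_funX; exact: measurable_coord.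
Qed.

End borel_row_vectors.

(** * Iterated integrals as integrals against a measure *)

Section iterated_integral_kernel.
Variables (R : realType).

Section precomposition.
Context d1 d2 d3 (X : measurableType d1) (Y : measurableType d2)
  (Z : measurableType d3).
Variables (h : X -> Y) (mh : measurable_fun setT h).

Definition kprecomp (k : Y -> {measure set Z -> \bar R}) (x : X) := k (h x).

Lemma sfinite_kernel_precomp (k : R.-sfker Y ~> Z) :
  exists k' : R.-sfker X ~> Z, forall x, k' x = k (h x) :> {measure set Z -> \bar R}.
Proof.
have mpre (k0 : R.-ker Y ~> Z) : isKernel _ _ X Z R (kprecomp k0).
  by split => U mU; exact: measurableT_comp (measurable_kernel k0 U mU) mh.
pose pk (k0 : R.-ker Y ~> Z) : R.-ker X ~> Z := HB.pack (kprecomp k0) (mpre k0).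
have sk : isSFiniteKernel_subdef _ _ X Z R (pk k).
  split; have [s sE] := sfinite_kernel k; exists (fun n => pk (s n)).
    move=> n; have [r sr] := measure_uub (s n); exists r => x; exact: sr.
  by move=> x U mU /=; rewrite /kprecomp sE.
by exists (HB.pack_for (R.-sfker X ~> Z) (pk k : X -> _) (mpre k) sk).
Qed.

(** Lets a fixed measure enter kernel compositions, and gives measurability of partial integrals
    through the theory of kernels. *)
Lemma sfinite_kernel_cst (m : {sfinite_measure set Z -> \bar R}) :
  exists k : R.-sfker X ~> Z, forall x, k x = m :> {measure set Z -> \bar R}.
Proof.
pose c (m0 : {measure set Z -> \bar R}) := fun _ : X => m0.
have mc m0 : isKernel _ _ X Z R (c m0) by split => U mU; exact: measurable_cst.
pose pk m0 : R.-ker X ~> Z := HB.pack (c m0) (mc m0).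
have sk : isSFiniteKernel_subdef _ _ X Z R (pk m).
  split; exists (fun n => pk (sfinite_measure_seq m n)).
    move=> n; exists (fine (sfinite_measure_seq m n setT) + 1) => x /=.
    have fn : sfinite_measure_seq m n setT \is a fin_num by exact: fin_num_measure.
    by rewrite EFinD fineK// lteDl// lte01.
  by move=> x U mU /=; rewrite /c sfinite_measure_seqP.
by exists (HB.pack_for (R.-sfker X ~> Z) (pk m : X -> _) (mc m) sk).
Qed.

End precomposition.

(** The empty list is the Dirac kernel; one more coordinate composes the constant Lebesgue kernel
    with the previous kernel precomposed with [setc]. Composition preserves s-finiteness. *)
Lemma iint_kernel (d : nat) (s : seq 'I_d) :
  exists k : R.-sfker 'rV[R]_d ~> 'rV[R]_d,
    forall x f, (forall z, 0 <= f z)%E -> measurable_fun setT f ->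
      (\int[k x]_z f z)%E = iint s f x.
Proof.
elim: s => [|i s [k kE]].
  have mid := @measurable_id _ 'rV[R]_d setT.
  exists (kdirac mid) => x f f0 mf /=.
  by rewrite /kdirac integral_dirac// diracT mul1e.
have [l lE] := @sfinite_kernel_cst _ _ 'rV[R]_d _ (@lebesgue_measure R).
have [k' k'E] := @sfinite_kernel_precomp _ _ _
  ('rV[R]_d * measurableTypeR R)%type _ _ _ (@measurable_setc R d i) k.
exists (l \; k')%E => x f f0 mf /=.
rewrite integral_kcomp// lE; apply: eq_integral => t _.
by rewrite k'E /= kE.
Qed.

End iterated_integral_kernel.

(** * Translation and reflection invariance on the line *)

Section lebesgue_line_invariance.
Import HBNNSimple.
Variable R : realType.
Implicit Types (f : measurableTypeR R -> \bar R) (a : R) (e : bool).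
Notation mu := (@lebesgue_measure R).

(* No measurability is needed: the integral of a nonnegative function is a
   supremum over the simple functions below it. *)
Lemma le_nnintegral d (T : measurableType d) (m : {measure set T -> \bar R})
    (f g : T -> \bar R) :
  (forall x, 0 <= f x)%E -> (forall x, f x <= g x)%E ->
  (\int[m]_x f x <= \int[m]_x g x)%E.
Proof.
move=> f0 fg; have g0 x : (0 <= g x)%E by apply: le_trans (fg x).
rewrite !ge0_integralE// !patch_setT; apply: le_ereal_sup => _ [h hf <-].
exists h => // x.
exact: le_trans (hf x) (fg x).
Qed.

Definition signed_shift e a (t : R) : R := (-1) ^+ e * t + a.

Lemma measurable_signed_shift e a :
  measurable_fun setT (signed_shift e a : measurableTypeR R -> measurableTypeR R).
Proof. by apply: measurable_funD => //; exact: measurable_funM. Qed.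

(** Uniqueness of Lebesgue measure, tested on the intervals []p, q]]. A reflection exchanges the
    open and the closed end, hence the two shapes of preimage, of equal length. *)
Lemma lebesgue_measure_signed_shift e a (A : set (measurableTypeR R)) :
  measurable A -> mu (signed_shift e a @^-1` A) = mu A.
Proof.
move=> mA; apply/esym.
have ms := measurable_signed_shift e a.
pose nu : {measure set (measurableTypeR R) -> \bar R} :=
  measure_function_pushforward__canonical__measure_function_Measure mu ms.
rewrite -[RHS]/(nu A); apply: lebesgue_measure_unique => // _ [[p q] _ <-].
rewrite /= /pushforward.
rewrite (_ : _ @^-1` _ = if e then `[a - q, a - p[%classic else `]p - a, q - a]%classic).
  have h : (a - q < a - p) = (p < q) by rewrite ltrD2l ltrN2.
  have h' : (p - a < q - a) = (p < q) by rewrite ltrD2r.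
  case: (e); rewrite !lebesgue_measure_itv/= !lte_fin ?h ?h'; case: ifP => // _;
    by rewrite -!EFinB; congr EFin; lra.
by clear nu ms; case: e => /=; apply/seteqP; split => x /=;
  rewrite /signed_shift/= !in_itv/= ?expr1 ?expr0; lra.
Qed.

Lemma integral_signed_shift e a f :
  (forall t, 0 <= f t)%E -> measurable_fun setT f ->
  (\int[mu]_t f (signed_shift e a t) = \int[mu]_t f t)%E.
Proof.
move=> f0 mf; have ms := measurable_signed_shift e a.
have := ge0_integral_pushforward ms mu measurableT mf (fun x _ => f0 x).
rewrite preimage_setT => <-; apply: eq_measure_integral => A mA _.
exact: lebesgue_measure_signed_shift.
Qed.

End lebesgue_line_invariance.

(** * Lebesgue measure on R^d *)

Section lebesgue_measure_rV.
Variables (R : realType) (d : nat).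
Notation V := 'rV[R]_d.
Implicit Types (s : seq 'I_d) (f g : V -> \bar R) (x y z : V).

Lemma measurable_iint s f : (forall z, 0 <= f z)%E -> measurable_fun setT f ->
  measurable_fun setT (iint s f).
Proof.
move=> f0 mf; have [k kE] := iint_kernel R s.
rewrite (_ : iint s f = fun x => (\int[k x]_z f z)%E).
  by apply: measurable_fun_integral_kernel => // U mU; exact: measurable_kernel.
by apply/funext => x; rewrite kE.
Qed.

Lemma iint_ge0 s f x : (forall z, 0 <= f z)%E -> (0 <= iint s f x)%E.
Proof. by move=> f0; elim: s x => [|i s IH] x //=; exact: integral_ge0. Qed.

Lemma le_iint s f g x : (forall z, 0 <= f z)%E -> (forall z, f z <= g z)%E ->
  (iint s f x <= iint s g x)%E.
Proof.
move=> f0 fg; elim: s x => [|i s IH] x //=; apply: le_nnintegral => // t.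
exact: iint_ge0.
Qed.

(** Coordinates in [s] are overwritten before [f] is evaluated. For the full enumeration the base
    point is thus irrelevant, which turns [iint_signed_shift] into invariance of the integral. *)
Lemma eq_iint_coord s f x y : (forall j, j \notin s -> x ord0 j = y ord0 j) ->
  iint s f x = iint s f y.
Proof.
elim: s x y => [|i s IH] x y xy /=; first by congr f; apply/rowP => j; exact: xy.
apply: eq_integral => t _; apply: IH => j js; rewrite !mxE.
by case: eqP => // /eqP ji; apply: xy; rewrite inE negb_or ji.
Qed.

Definition rV_signed_shift (e : 'I_d -> bool) z x : V :=
  \row_j signed_shift (e j) (z ord0 j) (x ord0 j).

Lemma measurable_rV_signed_shift e z : measurable_fun setT (rV_signed_shift e z).
Proof.
apply: measurable_fun_rV => j.
rewrite (_ : (fun _ => _) = signed_shift (e j) (z ord0 j) \o (fun x : V => x ord0 j)).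
  by apply: measurableT_comp; [exact: measurable_signed_shift|exact: measurable_coord].
by apply/funext => x; rewrite /= mxE.
Qed.

(** Invariance on the line absorbs the shift of each integrated coordinate; the shifted base point
    on the right accounts for the coordinates not yet integrated, which makes the induction go
    through. *)
Lemma iint_signed_shift s e z f x :
  (forall y, 0 <= f y)%E -> measurable_fun setT f ->
  iint s (f \o rV_signed_shift e z) x = iint s f (rV_signed_shift e z x).
Proof.
move=> f0 mf; elim: s x => [//|i s IH] x /=.
rewrite -[RHS](integral_signed_shift (e i) (z ord0 i)); first last.
- exact: measurableT_comp (measurable_iint s f0 mf)
    (measurableT_comp (measurable_setc i) (pair1_measurable _)).
- by move=> t; exact: iint_ge0.
apply: eq_integral => t _; rewrite IH; congr iint.
by apply/rowP => j; rewrite !mxE; case: eqP => // ->.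
Qed.

(** Read off from the kernel of the full iterated integral, so that [intRdE] holds by
    construction. *)
Definition rV_lebesgue : {measure set V -> \bar R} :=
  projT1 (cid (iint_kernel R (enum 'I_d))) 0.

Lemma rV_lebesgue_sfinite : sfinite_measure rV_lebesgue.
Proof. exact: sfinite_kernel_measure. Qed.

Notation mu := rV_lebesgue.

Lemma measurable_rV_integral (f : V * V -> \bar R) : (forall p, 0 <= f p)%E ->
  measurable_fun setT f -> measurable_fun setT (fun x => \int[mu]_y f (x, y))%E.
Proof.
move=> f0 mf.
pose m : {sfinite_measure set V -> \bar R} := HB.pack (mu : set V -> \bar R)
  (Measure.class mu) (@isSFinite.Build _ V R mu rV_lebesgue_sfinite).
have [k kE] := @sfinite_kernel_cst R _ _ V _ m.
rewrite (_ : (fun x => _) = (fun x => \int[k x]_y f (x, y))%E).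
  exact: measurable_fun_integral_sfinite_kernel.
by apply/funext => x; rewrite kE.
Qed.

Lemma rV_Fubini (f : V * V -> \bar R) : (forall p, 0 <= f p)%E ->
  measurable_fun setT f ->
  (\int[mu]_x \int[mu]_y f (x, y) = \int[mu]_y \int[mu]_x f (x, y))%E.
Proof.
move=> f0 mf.
pose m : {sfinite_measure set V -> \bar R} := HB.pack (mu : set V -> \bar R)
  (Measure.class mu) (@isSFinite.Build _ V R mu rV_lebesgue_sfinite).
exact: (@sfinite_Fubini _ _ _ _ _ m m f f0 mf).
Qed.

Lemma intRdE f : (forall z, 0 <= f z)%E -> measurable_fun setT f ->
  intRd f = (\int[mu]_z f z)%E.
Proof.
by move=> f0 mf; rewrite /rV_lebesgue; case: cid => k kE /=; rewrite kE.
Qed.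

Lemma rV_integral_signed_shift e z f :
  (forall y, 0 <= f y)%E -> measurable_fun setT f ->
  (\int[mu]_x f (rV_signed_shift e z x) = \int[mu]_x f x)%E.
Proof.
move=> f0 mf; have mfs : measurable_fun setT (f \o rV_signed_shift e z).
  exact: measurableT_comp mf (measurable_rV_signed_shift e z).
rewrite -[RHS]intRdE//.
transitivity (intRd (f \o rV_signed_shift e z)); first by rewrite intRdE// => y; exact: f0.
rewrite /intRd iint_signed_shift//.
by apply: eq_iint_coord => j; rewrite mem_enum.
Qed.

Lemma rV_integral_shift z f :
  (forall y, 0 <= f y)%E -> measurable_fun setT f ->
  (\int[mu]_x f (x + z)%R = \int[mu]_x f x)%E.
Proof.
move=> f0 mf; rewrite -(rV_integral_signed_shift (fun=> false) z f0 mf).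
apply: eq_integral => x _; congr f; apply/rowP => j.
by rewrite !mxE /signed_shift expr0 mul1r.
Qed.

Lemma iint_cube_le s (M : R) x : 0 <= M -> uniq s ->
  (iint s (fun y : V => if `[< forall j, (`|y ord0 j| <= M)%R >] then 1%E else 0%E) x
     <= ((M *+ 2) ^+ size s)%:E)%E.
Proof.
move=> M0; elim: s x => [|i s IH] x /=.
  by move=> _; case: asboolP => // _; rewrite lee_fin ler01.
move=> /andP[si us].
(* Integrating over [s] leaves coordinate [i] fixed, so once it exceeds [M] the indicator stays
   zero. The integral along [i] thus only sees an interval of length [M *+ 2]. *)
have z0 (y : V) : M < `|y ord0 i| ->
    iint s (fun y : V => if `[< forall j, (`|y ord0 j| <= M)%R >] then 1%E else 0%E) y = 0%E.
  elim: s si {IH us} y => [|j s IH] /= si y yM.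
    by case: asboolP => // /(_ i); rewrite leNgt yM.
  rewrite (eq_integral (cst 0%E)) ?integral0// => t _; apply: IH.
    by move: si; rewrite inE negb_or => /andP[].
  by rewrite mxE; case: eqP si => // ->; rewrite inE eqxx.
apply: (@le_trans _ _ (\int[lebesgue_measure]_t
    (((M *+ 2) ^+ size s)%:E * (\1_(`[(- M)%R, M]%classic) t)%:E))%E).
  apply: le_nnintegral => t; first by apply: iint_ge0 => z; case: asboolP.
  rewrite indicE; have [tM|tM] := boolP (t \in _) => /=.
    by rewrite mule1; exact: IH.
  rewrite mule0 z0//; rewrite mxE eqxx ltNge.
  by apply: contra tM => tM; rewrite inE /= in_itv /= -ler_norml.
rewrite ge0_integralZl_EFin//; last 2 first.
- by apply/measurable_EFinP; exact: measurable_indic.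
- by rewrite exprn_ge0// mulrn_wge0.
rewrite integral_indic// setIT /= lebesgue_measure_itv /= lte_fin.
case: ifPn => _; last by rewrite mule0 lee_fin exprn_ge0// mulrn_wge0.
by rewrite -EFinB opprK -EFinM lee_fin exprSr mulr2n.
Qed.

Lemma rV_lebesgue_bounded (A : set V) (M : R) : measurable A ->
  (forall x, A x -> forall j, `|x ord0 j| <= M) -> (mu A < +oo)%E.
Proof.
move=> mA AM.
rewrite -(setIT A) -integral_indic// -intRdE; first last.
- by apply/measurable_EFinP; exact: measurable_indic.
- by move=> x; rewrite lee_fin.
(* [M] is allowed to be negative, while a cube needs a nonnegative half-side. *)
have M0 : 0 <= Num.max 0 M by rewrite le_max lexx.
apply: (le_lt_trans _ (ltry ((Num.max 0 M *+ 2) ^+ size (enum 'I_d)))).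
apply: le_trans (iint_cube_le 0 M0 (enum_uniq _)).
apply: le_iint => x; first by rewrite lee_fin.
rewrite indicE; have [xA|] := boolP (x \in A); last by case: asboolP.
rewrite asboolT// => j; rewrite le_max; apply/orP; right.
by apply: AM; rewrite inE in xA.
Qed.

End lebesgue_measure_rV.

(** * Inequalities and second moments of radial kernels *)

Section weighted_comparison.
Local Open Scope ereal_scope.
Context d (T : measurableType d) (R : realType) (m : {measure set T -> \bar R}).

Lemma le_integral_comb (f g h : T -> \bar R) (p q : R) :
  (0 <= p)%R -> (0 <= q)%R -> (forall x, 0 <= f x) ->
  (forall x, 0 <= g x) -> (forall x, 0 <= h x) ->
  measurable_fun setT g -> measurable_fun setT h ->
  (forall x, f x <= p%:E * g x + q%:E * h x) ->
  \int[m]_x f x <= p%:E * \int[m]_x g x + q%:E * \int[m]_x h x.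
Proof.
move=> p0 q0 f0 g0 h0 mg mh fgh.
rewrite -!ge0_integralZl_EFin// -ge0_integralD//.
- exact: le_nnintegral.
- by move=> x _; rewrite mule_ge0.
- exact: measurable_funeM.
- by move=> x _; rewrite mule_ge0.
- exact: measurable_funeM.
Qed.

Lemma le_integral_comb3 (f g h l : T -> \bar R) (p q s : R) :
  (0 <= p)%R -> (0 <= q)%R -> (0 <= s)%R -> (forall x, 0 <= f x) ->
  (forall x, 0 <= g x) -> (forall x, 0 <= h x) -> (forall x, 0 <= l x) ->
  measurable_fun setT g -> measurable_fun setT h -> measurable_fun setT l ->
  (forall x, f x <= p%:E * g x + (q%:E * h x + s%:E * l x)) ->
  \int[m]_x f x <=
    p%:E * \int[m]_x g x + (q%:E * \int[m]_x h x + s%:E * \int[m]_x l x).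
Proof.
move=> p0 q0 s0 f0 g0 h0 l0 mg mh ml fghl.
have := @le_integral_comb f g (fun x => q%:E * h x + s%:E * l x) p 1.
rewrite mul1e => H; apply: le_trans (H _ _ _ _ _ _ _ _) _ => //.
- by move=> x; rewrite adde_ge0// mule_ge0.
- by apply: emeasurable_funD; exact: measurable_funeM.
- by move=> x; rewrite mul1e.
apply: leeD => //; apply: le_integral_comb => // x.
by rewrite adde_ge0// mule_ge0.
Qed.

(** Lets [e] tend to 0 without knowing beforehand that [a] or [b] is finite: an infinite [b] is
    trivial, and for finite [b] the bound at [e = 1/2] excludes an infinite [a]. *)
Lemma le_eps (a b : \bar R) (k c : R) : (0 <= k)%R -> (0 <= c)%R -> 0 <= b ->
  (forall e : R, (0 < e < 1)%R -> a <= (1 + k * e)%:E * b + (e * c)%:E) -> a <= b.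
Proof.
move=> k0 c0; case: b => [b| |] // b0 h; last by rewrite leey.
rewrite lee_fin in b0.
case: a h => [a| |] h; last by rewrite leNye.
  rewrite lee_fin leNgt; apply/negP => ba.
  have C0 : (0 < k * b + c + 1)%R by rewrite ltr_wpDl// addr_ge0// mulr_ge0.
  have e0 : (0 < (a - b) / (k * b + c + 1))%R by rewrite divr_gt0// subr_gt0.
  (* Chosen so that the total excess [e * (k * b + c)] is at most half the gap [a - b]; the [+ 1]
     keeps the divisor positive and the minimum keeps [e] below 1. *)
  pose e := Num.min (2^-1)%R ((a - b) / (k * b + c + 1) / 2)%R.
  have /h : (0 < e < 1)%R.
    by rewrite lt_min gt_min invr_gt0 ltr0n divr_gt0//= invf_lt1 ?ltr1n// ltr0n.
  rewrite -EFinM -EFinD lee_fin => /le_lt_trans.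
  have ee : (e * (k * b + c + 1) <= (a - b) / 2)%R.
    by rewrite -ler_pdivlMr// mulrAC ge_min lexx orbT.
  have e1 : (0 < e)%R by rewrite lt_min invr_gt0 ltr0n divr_gt0.
  by move=> /(_ a); rewrite ltxx => H; suff: false by []; apply: H; nra.
have /h : (0 < (2^-1 : R) < 1)%R by rewrite invr_gt0 ltr0n invf_lt1 ?ltr1n ?ltr0n.
by rewrite -EFinM -EFinD leNgt ltry.
Qed.

Lemma double_inj_ge0 (x y : \bar R) : 0 <= x -> 0 <= y -> x + x = y + y -> x = y.
Proof.
case: x => [x| |]; case: y => [y| |] //= _ _.
by rewrite -!EFinD => -[xy]; congr EFin; lra.
Qed.

End weighted_comparison.

Lemma sqr_le_weighted (R : realType) (e a b : R) : 0 < e ->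
  a ^+ 2 <= (1 + e) * b ^+ 2 + (1 + e^-1) * (a - b) ^+ 2.
Proof.
move=> e0; rewrite -subr_ge0 [leRHS](_ : _ = e * (b - (a - b) / e) ^+ 2).
  by rewrite mulr_ge0 ?sqr_ge0// ltW.
by field; rewrite gt_eqF.
Qed.

(** The cost of chaining two weighted inequalities when the error terms are of size [e^2]:
    [(1 + 1/e) e^2 = e (1 + e)] is still O(e). *)
Lemma young_weight_bounds (R : realType) (e : R) : (0 < e < 1) ->
  ((1 + e) * (1 + e) <= 1 + 3 * e) /\
  ((1 + e) * ((1 + e^-1) * e ^+ 2) <= 4 * e) /\ ((1 + e^-1) * e ^+ 2 <= 2 * e).
Proof.
move=> /andP[e0 e1]; rewrite (_ : (1 + e^-1) * e ^+ 2 = e * (1 + e)).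
  by split; [nra|split; nra].
by field; rewrite gt_eqF.
Qed.

Lemma sqrB_le (R : realType) (a b : R) : (a - b) ^+ 2 <= 2 * a ^+ 2 + 2 * b ^+ 2.
Proof. by have := sqr_ge0 (a + b); rewrite !expr2; nra. Qed.

Lemma sqrD_le (R : realType) (a b : R) : (a + b) ^+ 2 <= 2 * a ^+ 2 + 2 * b ^+ 2.
Proof. by have := sqrB_le a (- b); rewrite opprK sqrrN. Qed.

(** * Euclidean norm and inner product *)

Section euclidean.
Variables (R : realType) (d : nat).
Notation V := 'rV[R]_d.
Implicit Types x y z : V.

Definition dotv x y : R := \sum_j x ord0 j * y ord0 j.

Lemma norm2_ge0 x : 0 <= norm2 x. Proof. exact: sqrtr_ge0. Qed.

Lemma sqr_norm2 x : norm2 x ^+ 2 = \sum_j x ord0 j ^+ 2.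
Proof. by rewrite sqr_sqrtr// sumr_ge0// => j _; rewrite sqr_ge0. Qed.

Lemma norm2_0 : norm2 (0 : V) = 0.
Proof.
by apply/eqP; rewrite -sqrf_eq0 sqr_norm2 big1// => j _; rewrite mxE expr0n.
Qed.

Lemma norm2Z (a : R) x : norm2 (a *: x) = `|a| * norm2 x.
Proof.
apply/eqP; rewrite -(@eqrXn2 _ 2)// ?mulr_ge0 ?norm2_ge0//; apply/eqP.
rewrite exprMn !sqr_norm2 real_normK ?num_real// mulr_sumr.
by apply: eq_bigr => j _; rewrite mxE exprMn.
Qed.

Lemma norm2N x : norm2 (- x) = norm2 x.
Proof. by rewrite -scaleN1r norm2Z normrN1 mul1r. Qed.

Lemma coord_le_norm2 x j : `|x ord0 j| <= norm2 x.
Proof.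
rewrite -(@ler_pXn2r _ 2)// ?nnegrE ?norm2_ge0// sqr_norm2 (bigD1 j)//=.
by rewrite real_normK ?num_real// lerDl sumr_ge0// => i _; rewrite sqr_ge0.
Qed.

Lemma dotvBl x y z : dotv (x - y) z = dotv x z - dotv y z.
Proof.
by rewrite /dotv -sumrB; apply: eq_bigr => j _; rewrite !mxE mulrBl.
Qed.

Lemma dotv0l z : dotv 0 z = 0.
Proof. by rewrite /dotv big1// => j _; rewrite mxE mul0r. Qed.

Lemma dotvZr (a : R) x z : dotv x (a *: z) = a * dotv x z.
Proof. by rewrite mulr_sumr; apply: eq_bigr => j _; rewrite mxE; ring. Qed.

(** Lagrange's identity: twice the deficit is the sum of the squared two-by-two minors of [x] and
    [y]. *)
Lemma dotv_cauchy_schwarz x y : dotv x y ^+ 2 <= norm2 x ^+ 2 * norm2 y ^+ 2.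
Proof.
rewrite -subr_ge0 -(@pmulr_rge0 _ 2)//.
rewrite [leRHS](_ : _ = \sum_i \sum_j
   (x ord0 i * y ord0 j - x ord0 j * y ord0 i) ^+ 2); last first.
  rewrite mulrBr !sqr_norm2 [dotv x y ^+ 2]expr2 /dotv !big_distrlr /=.
  transitivity (\sum_i \sum_j (x ord0 i ^+ 2 * y ord0 j ^+ 2)
    + \sum_i \sum_j (x ord0 j ^+ 2 * y ord0 i ^+ 2)
    - 2 * \sum_i \sum_j (x ord0 i * y ord0 i * (x ord0 j * y ord0 j))).
    by rewrite [X in _ + X - _]exchange_big /=; congr (_ - _); ring.
  rewrite mulr_sumr -big_split -sumrB /=; apply: eq_bigr => i _.
  by rewrite mulr_sumr -big_split -sumrB /=; apply: eq_bigr => j _; ring.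
by apply: sumr_ge0 => i _; apply: sumr_ge0 => j _; rewrite sqr_ge0.
Qed.

Lemma measurable_rV_coord d' (T : measurableType d') (f : T -> V) j :
  measurable_fun setT f -> measurable_fun setT (fun t => f t ord0 j).
Proof. by move=> mf; exact: measurableT_comp (measurable_coord j) mf. Qed.

Lemma measurable_dotv d' (T : measurableType d') (f g : T -> V) :
  measurable_fun setT f -> measurable_fun setT g ->
  measurable_fun setT (fun t => dotv (f t) (g t)).
Proof.
move=> mf mg; apply: measurable_sum => j.
by apply: measurable_funM; exact: measurable_rV_coord.
Qed.

Lemma measurable_norm2 d' (T : measurableType d') (f : T -> V) :
  measurable_fun setT f -> measurable_fun setT (fun t => norm2 (f t)).
Proof. by move=> mf; apply: measurableT_comp mf; exact: measurable_fun_norm2. Qed.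

End euclidean.

(** * Second moments of radial kernels *)

Section radial_moments.
Local Open Scope ereal_scope.
Variables (R : realType) (d : nat).
Notation V := 'rV[R]_d.
Notation mu := (@rV_lebesgue R d).
Variable k : R -> R.
Hypotheses (k0 : forall t, (0 <= k t)%R) (mk : measurable_fun setT k).

Lemma measurable_radial : measurable_fun setT (fun z : V => k (norm2 z)).
Proof. by apply: measurableT_comp mk _; exact: measurable_fun_norm2. Qed.

Let measurable_weight (f : V -> R) : measurable_fun setT f ->
  measurable_fun setT (fun z : V => (f z ^+ 2 * k (norm2 z))%:E).
Proof.
move=> mf; apply/measurable_EFinP; apply: measurable_funM.
  exact: measurable_funX.
exact: measurable_radial.
Qed.

Let measurable_partial_dot (s : seq 'I_d) (g : V) :
  measurable_fun setT (fun z : V => (\sum_(j <- s) g ord0 j * z ord0 j)%R).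
Proof.
apply: measurable_sum => j; apply: measurable_funM => //; exact: measurable_coord.
Qed.

(* Reflecting the i-th coordinate kills the cross terms; adding the integrals of
   (a + b)^2 and (b - a)^2 keeps every integrand nonnegative. *)
Lemma radial_second_moments (g : V) :
  \int[mu]_z (dotv g z ^+ 2 * k (norm2 z))%:E =
  \sum_j (g ord0 j ^+ 2)%:E * \int[mu]_z ((z ord0 j ^+ 2 * k (norm2 z))%:E).
Proof.
(* Duplicate-free partial lists keep the head coordinate out of the remaining sum, so reflecting it
   changes the sign of [a] and leaves [b] fixed. *)
suff H (s : seq 'I_d) : uniq s ->
    \int[mu]_z ((\sum_(j <- s) g ord0 j * z ord0 j)%R ^+ 2 * k (norm2 z))%:E =
    \sum_(j <- s) (g ord0 j ^+ 2)%:E * \int[mu]_z ((z ord0 j ^+ 2 * k (norm2 z))%:E).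
  have := H (index_enum 'I_d) (index_enum_uniq _); exact.
elim: s => [_|i s IH /= /andP[si us]].
  rewrite big_nil (eq_integral (cst 0)) ?integral0// => z _.
  by rewrite big_nil expr0n /= mul0r.
rewrite big_cons -IH//.
have w0 (f : V -> R) z : 0 <= (f z ^+ 2 * k (norm2 z))%:E.
  by rewrite lee_fin mulr_ge0// sqr_ge0.
pose b (z : V) := (\sum_(j <- s) g ord0 j * z ord0 j)%R.
pose a (z : V) := (g ord0 i * z ord0 i)%R.
have mb : measurable_fun setT b by exact: measurable_partial_dot.
have ma : measurable_fun setT a.
  by apply: measurable_funM => //; exact: measurable_coord.
transitivity (\int[mu]_z ((a z + b z)%R ^+ 2 * k (norm2 z))%:E).
  by apply: eq_integral => z _; rewrite big_cons.
rewrite -ge0_integralZl_EFin ?sqr_ge0//; last 2 first.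
- by move=> z _; exact: (w0 (fun z : V => z ord0 i)).
- exact: (measurable_weight (measurable_coord i)).
rewrite [X in _ = X + _](_ : _ = \int[mu]_z (a z ^+ 2 * k (norm2 z))%:E); last first.
  by apply: eq_integral => z _; rewrite -EFinM mulrA -exprMn.
have flip : \int[mu]_z ((a z + b z)%R ^+ 2 * k (norm2 z))%:E =
    \int[mu]_z ((b z - a z)%R ^+ 2 * k (norm2 z))%:E.
  rewrite -(rV_integral_signed_shift (pred1 i) 0); first last.
  - by apply: (measurable_weight (f := fun z => a z + b z)%R); exact: measurable_funD.
  - by move=> z; exact: (w0 (fun z => a z + b z)%R).
  apply: eq_integral => z _; set z' := rV_signed_shift _ _ _.
  have z'E j : z' ord0 j = ((-1) ^+ (j == i) * z ord0 j)%R.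
    by rewrite !mxE /signed_shift addr0.
  have -> : norm2 z' = norm2 z.
    congr Num.sqrt; apply: eq_bigr => j _; rewrite z'E exprMn -exprM mulnC exprM.
    by rewrite sqrrN expr1n expr1n mul1r.
  have -> : a z' = (- a z)%R by rewrite /a z'E eqxx; ring.
  have -> : b z' = b z.
    rewrite /b; apply: eq_big_seq => j js; rewrite z'E.
    have /negPf -> : j != i by apply: contraNneq si => <-.
    by rewrite expr0 mul1r.
  by rewrite addrC.
apply: double_inj_ge0.
- by apply: integral_ge0 => z _; exact: (w0 (fun z => a z + b z)%R).
- apply: adde_ge0; apply: integral_ge0 => z _; [exact: (w0 a)|exact: (w0 b)].
have mab : measurable_fun setT (fun z => a z + b z)%R by exact: measurable_funD.
have mba : measurable_fun setT (fun z => b z - a z)%R by exact: measurable_funB.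
have I (f g' : V -> R) : measurable_fun setT f -> measurable_fun setT g' ->
    \int[mu]_z (f z ^+ 2 * k (norm2 z))%:E + \int[mu]_z (g' z ^+ 2 * k (norm2 z))%:E
    = \int[mu]_z ((f z ^+ 2 + g' z ^+ 2) * k (norm2 z))%:E.
  move=> mf mg; rewrite -ge0_integralD//.
  - by apply: eq_integral => z _; rewrite -EFinD mulrDl.
  - exact: measurable_weight.
  - exact: measurable_weight.
rewrite {2}flip (I (fun z => a z + b z)%R (fun z => b z - a z)%R)// (I a b)//.
have mw : measurable_fun setT (fun z => ((a z ^+ 2 + b z ^+ 2) * k (norm2 z))%:E).
  apply/measurable_EFinP; apply: measurable_funM; last exact: measurable_radial.
  by apply: measurable_funD; exact: measurable_funX.
rewrite -ge0_integralD//; last 2 first.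
- by move=> z _; rewrite lee_fin mulr_ge0// addr_ge0// sqr_ge0.
- by move=> z _; rewrite lee_fin mulr_ge0// addr_ge0// sqr_ge0.
by apply: eq_integral => z _; rewrite -EFinD; congr EFin; ring.
Qed.

Lemma radial_norm_moment :
  (forall j : 'I_d, \int[mu]_z ((z ord0 j ^+ 2 * k (norm2 z))%:E) = 1) ->
  \int[mu]_z (norm2 (z : V) ^+ 2 * k (norm2 z))%:E = d%:R%:E.
Proof.
move=> k1; transitivity (\int[mu]_z \sum_(j < d) (z ord0 j ^+ 2 * k (norm2 z))%:E).
  by apply: eq_integral => z _; rewrite sqr_norm2 mulr_suml -sumEFin.
rewrite ge0_integral_sum.
- by rewrite (eq_bigr (fun=> 1%:E))// sumEFin sumr_const card_ord.
- exact: measurableT.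
- by move=> j; exact: (measurable_weight (measurable_coord j)).
- by move=> j z _; rewrite lee_fin mulr_ge0// sqr_ge0.
Qed.

End radial_moments.

(** * The upper bound *)

Section sobolev_pairs.
Local Open Scope ereal_scope.
Variables (R : realType) (d : nat) (Om : set 'rV[R]_d).
Notation V := 'rV[R]_d.
Notation mu := (@rV_lebesgue R d).
Implicit Types (u phi : V -> R) (G H : V -> V) (x y z : V).

Definition measurable_pair u G :=
  measurable_fun setT u /\ measurable_fun setT G.

(* All that is used of a function of class C^1_c(Om) and its gradient. *)
Record test_pair phi G : Prop := TestPair {
  test_measurable : measurable_pair phi G ;
  test_support : exists K : set V, [/\ compact K, K `<=` Om &
    forall x, ~ K x -> phi x = 0%R /\ G x = 0%R] ;
  test_bounded : exists B : R, forall x, (norm2 (G x) <= B)%R ;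
  test_taylor : forall e : R, (0 < e)%R -> exists2 r : R, (0 < r)%R &
    forall x z, (norm2 z <= r)%R ->
      (`|phi (x + z) - phi x - dotv (G x) z| <= e * norm2 z)%R }.

(** The closure of the test pairs in the H^1 norm of the whole space: a function of H^1_0, extended
    by zero, together with its weak gradient. *)
Definition sobolev_pair u G := measurable_pair u G /\
  forall e : R, (0 < e)%R -> exists phi H, [/\ test_pair phi H,
    \int[mu]_x ((phi x - u x) ^+ 2)%:E <= e%:E &
    \int[mu]_x (norm2 (H x - G x) ^+ 2)%:E <= e%:E].

Lemma measurable_pairB u G phi H : measurable_pair u G -> measurable_pair phi H ->
  measurable_pair (fun x => u x - phi x)%R (fun x => G x - H x)%R.
Proof.
by move=> [mu_ mG] [mp mH]; split; [exact: measurable_funB|exact: measurable_rVB].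
Qed.

Lemma norm2_sqrB_le x y : (norm2 (x - y) ^+ 2 <= 2 * norm2 x ^+ 2 + 2 * norm2 y ^+ 2)%R.
Proof.
rewrite !sqr_norm2 !mulr_sumr -big_split; apply: ler_sum => j _ /=.
by rewrite !mxE; exact: sqrB_le.
Qed.

Lemma test_pairB phi G psi H : test_pair phi G -> test_pair psi H ->
  test_pair (fun x => phi x - psi x)%R (fun x => G x - H x)%R.
Proof.
move=> [mp [K [cK KOm K0]] [B hB] tp] [mq [L [cL LOm L0]] [C hC] tq]; split.
- exact: measurable_pairB.
- exists (K `|` L); split; first exact: compactU.
    by move=> x [/KOm|/LOm].
  move=> x /not_orP[/K0[-> ->] /L0[-> ->]].
  by rewrite !subr0.
- exists (Num.sqrt (2 * B ^+ 2 + 2 * C ^+ 2))%R => x.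
  rewrite -(@ler_pXn2r _ 2)// ?nnegrE ?norm2_ge0 ?sqrtr_ge0//.
  have S0 : (0 <= 2 * B ^+ 2 + 2 * C ^+ 2)%R.
    by rewrite addr_ge0// mulr_ge0// sqr_ge0.
  rewrite (sqr_sqrtr S0).
  apply: le_trans (norm2_sqrB_le _ _) _.
  have B0 : (0 <= B)%R by rewrite (le_trans (norm2_ge0 _) (hB x)).
  have C0 : (0 <= C)%R by rewrite (le_trans (norm2_ge0 _) (hC x)).
  by rewrite lerD// ler_pM2l// ler_pXn2r// ?nnegrE// norm2_ge0.
- move=> e e0; have e20 : (0 < e / 2)%R by rewrite divr_gt0.
  have [r r0 hr] := tp _ e20; have [s s0 hs] := tq _ e20.
  exists (Num.min r s); first by rewrite lt_min r0.
  move=> x z; rewrite le_min => /andP[/(hr x) h1 /(hs x) h2].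
  rewrite dotvBl [X in `|X|%R](_ : _ = (phi (x + z) - phi x - dotv (G x) z) -
    (psi (x + z) - psi x - dotv (H x) z))%R; last by ring.
  apply: le_trans (ler_normB _ _) _; apply: le_trans (lerD h1 h2) _.
  by rewrite -mulrDl -splitr.
Qed.

(** Makes the upper bound applicable to the approximation error [phi - u]. *)
Lemma sobolev_pair_subl u G phi H : test_pair phi H -> sobolev_pair u G ->
  sobolev_pair (fun x => phi x - u x)%R (fun x => H x - G x)%R.
Proof.
move=> tp [mug ug]; split; first by apply: measurable_pairB => //; case: tp.
move=> e /ug[psi [I [tq h1 h2]]].
exists (fun x => phi x - psi x)%R, (fun x => H x - I x)%R; split.
- exact: test_pairB.
- apply: le_trans h1; rewrite le_eqVlt; apply/orP; left; apply/eqP.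
  by apply: eq_integral => x _; congr EFin; ring.
- apply: le_trans h2; rewrite le_eqVlt; apply/orP; left; apply/eqP.
  apply: eq_integral => x _; rewrite -norm2N; congr ((norm2 _ ^+ 2)%R%:E).
  by apply/rowP => j; rewrite !mxE; ring.
Qed.

Definition increment u z : \bar R := \int[mu]_x ((u (x + z) - u x) ^+ 2)%:E.

Lemma measurable_shift z : measurable_fun setT (fun x : V => x + z)%R.
Proof. exact: measurable_rVD. Qed.

Lemma measurable_shift_fun u z : measurable_fun setT u ->
  measurable_fun setT (fun x => u (x + z)%R).
Proof. by move=> m; exact: measurableT_comp m (measurable_shift z). Qed.

Lemma measurable_increment u z : measurable_fun setT u ->
  measurable_fun setT (fun x => ((u (x + z) - u x) ^+ 2)%:E).
Proof.
move=> m; apply/measurable_EFinP/measurable_funX/measurable_funB => //.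
exact: measurable_shift_fun.
Qed.

Lemma measurable_sqr_dotv G z : measurable_fun setT G ->
  measurable_fun setT (fun x => (dotv (G x) z ^+ 2)%:E).
Proof. by move=> mG; apply/measurable_EFinP/measurable_funX/measurable_dotv. Qed.

Lemma measurable_sqr_norm2 G : measurable_fun setT G ->
  measurable_fun setT (fun x => (norm2 (G x) ^+ 2)%:E).
Proof. by move=> mG; apply/measurable_EFinP/measurable_funX/measurable_norm2. Qed.

Lemma sqr_EFin_ge0 (a : R) : 0 <= (a ^+ 2)%:E.
Proof. by rewrite lee_fin sqr_ge0. Qed.

(* Halving the step reduces the bound on increments to a first-order Taylor
   estimate, without integrating the gradient along segments. *)
Lemma increment_half u z : measurable_fun setT u ->
  increment u z <= 4%:E * increment u (2^-1 *: z).
Proof.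
move=> m; pose h : V := (2^-1 *: z)%R.
have zE : (z = h + h)%R by rewrite -scalerDl -[LHS]scale1r; congr (_ *: _)%R; lra.
have mi := measurable_increment h m.
apply: (@le_trans _ _ (2%:E * \int[mu]_x ((u (x + h + h) - u (x + h)) ^+ 2)%:E
   + 2%:E * increment u h)).
  apply: le_integral_comb => //.
  - by move=> x; exact: sqr_EFin_ge0.
  - by move=> x; exact: sqr_EFin_ge0.
  - by move=> x; exact: sqr_EFin_ge0.
  - exact: (measurableT_comp mi (measurable_shift h)).
  - move=> x; rewrite -!EFinM -EFinD lee_fin zE addrA.
    by rewrite [X in (X ^+ 2 <= _)%R](_ : _ = (u (x + h + h) - u (x + h)) +
      (u (x + h) - u x))%R; [exact: sqrD_le|ring].
rewrite (rV_integral_shift h (f := fun x => ((u (x + h) - u x) ^+ 2)%:E))//; last first.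
  by move=> x; exact: sqr_EFin_ge0.
rewrite -/(increment u h) -ge0_muleDl ?lee_fin// -EFinD.
by rewrite (_ : 2 + 2 = 4 :> R)%R//; lra.
Qed.

(** The factor [4 ^+ m] is exactly compensated by the quadratic scaling of the directional energy
    under the step [2^-1 ^+ m *: z], so iterating the halving loses nothing. *)
Lemma increment_dyadic u z m : measurable_fun setT u ->
  increment u z <= (4 ^+ m)%:E * increment u (2^-1 ^+ m *: z).
Proof.
move=> mm; elim: m => [|m IH]; first by rewrite !expr0 mul1e scale1r.
apply: (le_trans IH); rewrite exprSr EFinM -muleA exprS -scalerA.
apply: lee_wpmul2l; first by rewrite lee_fin exprn_ge0.
exact: increment_half.
Qed.


Hypothesis Om_bounded : exists M : R, forall x, Om x -> (norm2 x <= M)%R.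

Definition cube (M : R) : set V := [set x | forall j, (`|x ord0 j| <= M)%R].

Lemma measurable_cube M : measurable (cube M).
Proof.
rewrite (_ : cube M = \bigcap_(j in [set: 'I_d])
   ((fun x : V => `|x ord0 j|%R) @^-1` `]-oo, M]%classic)).
  apply: fin_bigcap_measurable => // j _; rewrite -[X in measurable X]setTI.
  apply: measurableT_comp (measurable_coord j) _ _ _ => //.
apply/seteqP; split => x h j; first by move=> _ /=; rewrite in_itv/=; exact: h.
by have := h j Logic.I; rewrite /= in_itv.
Qed.

Lemma rV_lebesgue_cube M : mu (cube M) \is a fin_num.
Proof.
rewrite ge0_fin_numE ?measure_ge0//.
by apply: (@rV_lebesgue_bounded _ _ _ M) => //; exact: measurable_cube.
Qed.

Lemma test_pair_increment phi G z : test_pair phi G ->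
  increment phi z <= \int[mu]_x (dotv (G x) z ^+ 2)%:E.
Proof.
move=> tp; have [[mp mG] [K [_ KOm K0]] _ taylor] := tp.
(* Outside [B] neither [x] nor [x + a *: z] with [0 <= a <= 1] lies in the support, so the Taylor
   remainder is integrated over a set of finite measure independent of the number of halvings. *)
have [M hM] := Om_bounded; pose B := cube (M + norm2 z).
have mB : measurable B by exact: measurable_cube.
have [b b0 muB] : exists2 b : R, (0 <= b)%R & mu B = b%:E.
  exists (fine (mu B)); first by rewrite fine_ge0.
  by rewrite fineK// rV_lebesgue_cube.
apply: (@le_eps _ _ _ 1%R (2 * norm2 z ^+ 2 * b)%R) => //.
- by rewrite !mulr_ge0 ?norm2_ge0.
- by apply: integral_ge0 => x _; exact: sqr_EFin_ge0.
move=> e /andP[e0 e1]; have e0' := ltW e0; have [r r0 hr] := taylor e e0.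
(* Enough halvings bring the step within the Taylor radius for [e]. *)
have [m hm] : exists m, (2^-1 ^+ m * norm2 z <= r)%R.
  have r1 : (0 < r / (norm2 z + 1))%R by rewrite divr_gt0// ltr_wpDl ?norm2_ge0.
  have : (2^-1 ^+ n : R)%R @[n --> \oo] --> (0 : R)%R.
    by apply: cvg_expr; rewrite ger0_norm// invf_lt1// ltr1n.
  move=> /cvgrPdist_lt /(_ _ r1)[n _ /(_ n (leqnn n))].
  rewrite sub0r normrN ger0_norm ?exprn_ge0// => h; exists n.
  move/ltW: h; rewrite ler_pdivlMr ?ltr_wpDl ?norm2_ge0//; apply: le_trans.
  by rewrite ler_wpM2l ?exprn_ge0// lerDl.
pose a : R := (2^-1 ^+ m)%R; pose q : R := (4^-1 ^+ m)%R.
have a0 : (0 <= a)%R by rewrite exprn_ge0.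
have aq : (a ^+ 2 = q)%R by rewrite /a /q -exprM mulnC exprM; congr (_ ^+ _)%R; rewrite expr2; field.
have q0 : (0 <= q)%R by rewrite exprn_ge0.
have ez : norm2 (a *: z) = (a * norm2 z)%R by rewrite norm2Z ger0_norm.
apply: le_trans (increment_dyadic z m mp) _.
have mI : measurable_fun setT (fun x => (\1_B x)%:E : \bar R).
  by apply/measurable_EFinP; exact: measurable_indic.
apply: (@le_trans _ _ ((4 ^+ m)%:E * (((1 + e) * q)%:E * \int[mu]_x (dotv (G x) z ^+ 2)%:E
   + ((1 + e^-1) * e ^+ 2 * q * norm2 z ^+ 2)%:E * \int[mu]_x (\1_B x)%:E))).
  apply: lee_wpmul2l; first by rewrite lee_fin exprn_ge0.
  apply: le_integral_comb => //.
  - by rewrite mulr_ge0// addr_ge0// ltW.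
  - by rewrite !mulr_ge0 ?norm2_ge0// addr_ge0// invr_ge0.
  - by move=> x; exact: sqr_EFin_ge0.
  - by move=> x; exact: sqr_EFin_ge0.
  - exact: measurable_sqr_dotv.
  move=> x; rewrite -!EFinM -EFinD lee_fin.
  have e1' : (0 <= 1 + e^-1)%R by rewrite addr_ge0// invr_ge0 ltW.
  have [xB|xB] := boolP (x \in B).
    rewrite indicE xB mulr1.
    apply: le_trans (sqr_le_weighted _ (dotv (G x) (a *: z)) e0) _.
    apply: lerD; first by rewrite dotvZr exprMn aq mulrA.
    rewrite [leRHS](_ : _ = (1 + e^-1) * (e * (a * norm2 z)) ^+ 2)%R; last first.
      by rewrite -aq; ring.
    apply: ler_wpM2l => //; have := hr x (a *: z)%R; rewrite ez => /(_ hm).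
    move=> h; rewrite -[leLHS]real_normK ?num_real//.
    by rewrite ler_pXn2r ?nnegrE// !mulr_ge0 ?norm2_ge0.
  have xK : ~ K x.
    move=> /KOm /hM xM; case/negP: xB; rewrite inE => j.
    apply: le_trans (coord_le_norm2 _ _) _; apply: le_trans xM _.
    by rewrite lerDl norm2_ge0.
  have xzK : ~ K (x + a *: z)%R.
    move=> /KOm /hM xM; case/negP: xB; rewrite inE => j.
    rewrite -(addrK ((a *: z) ord0 j) (x ord0 j)) [leLHS](_ : _ =
       `|(x + a *: z)%R ord0 j - (a *: z)%R ord0 j|)%R; last by rewrite !mxE.
    apply: le_trans (ler_normB _ _) _; apply: lerD.
      by apply: le_trans (coord_le_norm2 _ _) _.
    apply: le_trans (coord_le_norm2 _ _) _; rewrite ez.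
    by rewrite ler_piMl ?norm2_ge0// exprn_ile1// invf_le1// ler1n.
  rewrite (K0 _ xK).1 (K0 _ xzK).1 subrr expr0n /= addr_ge0//.
    by rewrite mulr_ge0 ?sqr_ge0// mulr_ge0// addr_ge0.
  by rewrite !mulr_ge0 ?norm2_ge0.
rewrite integral_indic// setIT [mu _]muB.
have I0 : 0 <= \int[mu]_x (dotv (G x) z ^+ 2)%:E.
  by apply: integral_ge0 => x _; exact: sqr_EFin_ge0.
rewrite ge0_muleDr; last 2 first.
- by rewrite mule_ge0// lee_fin mulr_ge0// addr_ge0// ltW.
- by rewrite -EFinM lee_fin !mulr_ge0 ?norm2_ge0// addr_ge0// invr_ge0.
have q4 : (4 ^+ m * q = 1)%R by rewrite /q -exprMn divff ?expr1n.
rewrite muleA -!EFinM [X in X%:E * _](_ : _ = 1 + 1 * e)%R; last first.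
  by rewrite mul1r mulrCA q4 mulr1.
rewrite leeD2l// lee_fin.
rewrite [leLHS](_ : _ = (4 ^+ m * q) * (e * (1 + e)) * norm2 z ^+ 2 * b)%R; last first.
  by field; rewrite gt_eqF.
rewrite q4 mul1r [leRHS](_ : _ = e * 2 * norm2 z ^+ 2 * b)%R; last by ring.
apply: ler_wpM2r => //; apply: ler_wpM2r; first exact: sqr_ge0.
by apply: ler_wpM2l => //; lra.
Qed.

(** By density. For the error [w = phi - u], closeness in L^2 alone controls the increment, by
    translation invariance; closeness of gradients enters through Cauchy-Schwarz. *)
Lemma sobolev_pair_increment u G z : sobolev_pair u G ->
  increment u z <= \int[mu]_x (dotv (G x) z ^+ 2)%:E.
Proof.
move=> [[mu_ mG] ap].
(* The [3] comes from [(1 + e)^2 <= 1 + 3 e], the [4 |z|^2] from replacing [H] by [G], and the [8]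
   from the increment of [w], at most [4 e^2], times [1 + 1/e]. *)
apply: (@le_eps _ _ _ 3%R (4 * norm2 z ^+ 2 + 8)%R) => //.
- by rewrite addr_ge0// mulr_ge0// sqr_ge0.
- by apply: integral_ge0 => x _; exact: sqr_EFin_ge0.
move=> e e01; have /andP[e0 e1] := e01.
have [w1 [w2 w3]] := young_weight_bounds e01.
have e' : (0 <= 1 + e)%R by rewrite addr_ge0// ltW.
have ei : (0 <= 1 + e^-1)%R by rewrite addr_ge0// invr_ge0 ltW.
have [phi [H [tp h1 h2]]] := ap (e ^+ 2)%R (exprn_gt0 _ e0).
have [mp mH] := test_measurable tp.
pose w x := (phi x - u x)%R; have mw : measurable_fun setT w by exact: measurable_funB.
have mw2 : measurable_fun setT (fun x => (w x ^+ 2)%:E).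
  by apply/measurable_EFinP/measurable_funX.
have iw : increment w z <= (4 * e ^+ 2)%:E.
  apply: (@le_trans _ _ (2%:E * \int[mu]_x (w (x + z)%R ^+ 2)%:E +
      2%:E * \int[mu]_x (w x ^+ 2)%:E)).
    apply: le_integral_comb => //; try by move=> x; exact: sqr_EFin_ge0.
      exact: (measurableT_comp mw2 (measurable_shift z)).
    by move=> x; rewrite -!EFinM -EFinD lee_fin; exact: sqrB_le.
  rewrite (rV_integral_shift z (f := fun x => (w x ^+ 2)%:E))//; last first.
    by move=> x; exact: sqr_EFin_ge0.
  rewrite -ge0_muleDl ?lee_fin// -EFinD (_ : 2 + 2 = 4 :> R)%R; last by lra.
  by rewrite EFinM; apply: lee_wpmul2l; rewrite ?lee_fin.
have mHG : measurable_fun setT (fun x => H x - G x)%R by exact: measurable_rVB.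
have iH : \int[mu]_x (dotv (H x) z ^+ 2)%:E <=
    (1 + e)%:E * \int[mu]_x (dotv (G x) z ^+ 2)%:E +
    ((1 + e^-1) * norm2 z ^+ 2 * e ^+ 2)%:E.
  apply: (@le_trans _ _ ((1 + e)%:E * \int[mu]_x (dotv (G x) z ^+ 2)%:E +
    ((1 + e^-1) * norm2 z ^+ 2)%:E * \int[mu]_x (norm2 (H x - G x)%R ^+ 2)%:E)).
    apply: le_integral_comb => //; try by move=> x; exact: sqr_EFin_ge0.
    - by rewrite mulr_ge0// sqr_ge0.
    - exact: measurable_sqr_dotv.
    - exact: (measurable_sqr_norm2 mHG).
    move=> x; rewrite -!EFinM -EFinD lee_fin.
    apply: le_trans (sqr_le_weighted _ (dotv (G x) z) e0) _.
    rewrite lerD2l -mulrA ler_wpM2l// -dotvBl mulrC.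
    exact: dotv_cauchy_schwarz.
  rewrite leeD2l// [leRHS]EFinM; apply: lee_wpmul2l => //.
  by rewrite lee_fin mulr_ge0// sqr_ge0.
apply: (@le_trans _ _ ((1 + e)%:E * increment phi z + (1 + e^-1)%:E * increment w z)).
  apply: le_integral_comb => //; try by move=> x; exact: sqr_EFin_ge0.
  - exact: measurable_increment.
  - exact: measurable_increment.
  move=> x; rewrite -!EFinM -EFinD lee_fin.
  apply: le_trans (sqr_le_weighted _ (phi (x + z) - phi x)%R e0) _.
  rewrite lerD2l ler_wpM2l// -sqrrN le_eqVlt; apply/orP; left; apply/eqP.
  by congr (_ ^+ 2)%R; rewrite /w; ring.
have I0 : 0 <= \int[mu]_x (dotv (G x) z ^+ 2)%:E.
  by apply: integral_ge0 => x _; exact: sqr_EFin_ge0.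
apply: (@le_trans _ _ ((1 + e)%:E * ((1 + e)%:E * \int[mu]_x (dotv (G x) z ^+ 2)%:E +
    ((1 + e^-1) * norm2 z ^+ 2 * e ^+ 2)%:E) + (1 + e^-1)%:E * (4 * e ^+ 2)%:E)).
  apply: leeD; apply: lee_wpmul2l => //; rewrite ?lee_fin//.
  exact: le_trans (test_pair_increment z tp) iH.
rewrite ge0_muleDr; last 2 first.
- by rewrite mule_ge0.
- by rewrite lee_fin !mulr_ge0 ?norm2_ge0// ltW.
rewrite muleA -!EFinM -addeA -EFinD; apply: leeD.
  by apply: lee_wpmul2r => //; rewrite lee_fin.
rewrite lee_fin mulrDr; apply: lerD.
  rewrite [leLHS](_ : _ = (1 + e) * ((1 + e^-1) * e ^+ 2) * norm2 z ^+ 2)%R; last by ring.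
  by rewrite mulrA ler_wpM2r ?sqr_ge0// [leRHS]mulrC.
by rewrite mulrCA [leRHS](_ : _ = 4 * (2 * e))%R ?ler_wpM2l//; ring.
Qed.

Lemma measurable_nonlocal u (k : R -> R) : measurable_fun setT u ->
  measurable_fun setT k ->
  measurable_fun setT (fun p : V * V => (k (norm2 p.2) * (u (p.1 + p.2) - u p.1) ^+ 2)%:E).
Proof.
move=> mu_ mk; apply/measurable_EFinP; apply: measurable_funM.
  by apply: measurableT_comp mk _; exact: (measurable_norm2 measurable_snd).
apply/measurable_funX/measurable_funB.
  by apply: measurableT_comp mu_ _; exact: measurable_rVD.
exact: measurableT_comp mu_ measurable_fst.
Qed.

Lemma nonlocal_shift u (k : R -> R) x : (forall t, (0 <= k t)%R) ->
  measurable_fun setT u -> measurable_fun setT k ->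
  \int[mu]_y ((u y - u x) ^+ 2 * k (norm2 (y - x)%R))%:E =
  \int[mu]_z (k (norm2 z) * (u (x + z) - u x) ^+ 2)%:E.
Proof.
move=> k0 mu_ mk.
pose f y := ((u y - u x) ^+ 2 * k (norm2 (y - x)%R))%:E.
rewrite -(rV_integral_shift x (f := f)).
- by apply: eq_integral => z _; rewrite /f addrK mulrC [(z + x)%R]addrC.
- by move=> y; rewrite lee_fin mulr_ge0// sqr_ge0.
- apply/measurable_EFinP; apply: measurable_funM.
    by apply/measurable_funX/measurable_funB.
  by apply: measurableT_comp mk _; apply: measurable_norm2; exact: measurable_rVB.
Qed.

Lemma sobolev_pair_nonlocal u G (k : R -> R) : sobolev_pair u G ->
  (forall t, (0 <= k t)%R) -> measurable_fun setT k ->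
  (forall j : 'I_d, \int[mu]_z ((z ord0 j ^+ 2 * k (norm2 z))%:E) = 1) ->
  \int[mu]_x \int[mu]_y ((u y - u x) ^+ 2 * k (norm2 (y - x)%R))%:E <=
  \int[mu]_x (norm2 (G x) ^+ 2)%:E.
Proof.
move=> sp k0 mk k1; have [[mu_ mG] _] := sp.
under eq_integral do rewrite nonlocal_shift//.
pose F (p : V * V) := (k (norm2 p.2) * (u (p.1 + p.2) - u p.1) ^+ 2)%:E.
pose D (p : V * V) := (k (norm2 p.2) * dotv (G p.1) p.2 ^+ 2)%:E.
have F0 p : 0 <= F p by rewrite lee_fin mulr_ge0// sqr_ge0.
have D0 p : 0 <= D p by rewrite lee_fin mulr_ge0// sqr_ge0.
have mD : measurable_fun setT D.
  apply/measurable_EFinP; apply: measurable_funM.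
    by apply: measurableT_comp mk _; exact: (measurable_norm2 measurable_snd).
  apply/measurable_funX; apply: (measurable_dotv _ measurable_snd).
  exact: measurableT_comp mG measurable_fst.
(* Integrating in [x] first gives access to the increment bound at fixed [z]; the order is exchanged
   back afterwards to evaluate the moments in [z] at fixed [G x]. *)
rewrite (rV_Fubini F0 (measurable_nonlocal mu_ mk)).
apply: (@le_trans _ _ (\int[mu]_z \int[mu]_x D (x, z))).
  apply: le_nnintegral => z; first by apply: integral_ge0.
  rewrite /F /D /=.
  under eq_integral do rewrite EFinM.
  rewrite ge0_integralZl_EFin//; last 2 first.
  - by move=> x _; exact: sqr_EFin_ge0.
  - exact: measurable_increment.
  under [leRHS]eq_integral do rewrite EFinM.
  rewrite ge0_integralZl_EFin//; last 2 first.
  - by move=> x _; exact: sqr_EFin_ge0.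
  - exact: measurable_sqr_dotv.
  by apply: lee_wpmul2l; [rewrite lee_fin|exact: sobolev_pair_increment].
rewrite -(rV_Fubini D0 mD) le_eqVlt; apply/orP; left; apply/eqP.
apply: eq_integral => x _; rewrite /D /=.
under eq_integral do rewrite mulrC.
rewrite (radial_second_moments k0 mk (G x)) sqr_norm2 -sumEFin.
by apply: eq_bigr => j _; rewrite k1 mule1.
Qed.

End sobolev_pairs.

(** * Test functions and polytopes *)

Section smooth_test_functions.
Variables (R : realType) (d : nat).
Notation V := 'rV[R]_d.
Implicit Types (x y z : V) (f : V -> R).

Lemma norm2_ball x z (r : R) : 0 < r -> norm2 z < r -> ball x r (x + z).
Proof.
move=> r0 zr; apply/rV_ball_coord => // j; rewrite mxE opprD addrA subrr sub0r normrN.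
exact: le_lt_trans (coord_le_norm2 z j) zr.
Qed.

Lemma nbhs_shift x (W : set V) : nbhs x W -> exists2 r : R, 0 < r &
  forall x' z, ball x r x' -> norm2 z < r -> W x' /\ W (x' + z).
Proof.
move=> /nbhs_ballP[r /= r0 rW]; exists (r / 2); first by rewrite divr_gt0.
have r20 : 0 < r / 2 by rewrite divr_gt0.
move=> x' z xx' zr; split; apply: rW.
  by apply: le_ball xx'; lra.
by rewrite (splitr r); apply: ball_triangle xx' _; exact: norm2_ball.
Qed.

(** A Lebesgue-number argument, by near-covering compactness along radii tending to 0. It yields
    both uniform continuity and a positive margin between a support and the boundary. *)
Lemma compact_uniform_shift (K : set V) (Q : V -> V -> Prop) : compact K ->
  (forall x, K x -> exists2 r : R, 0 < r &
     forall x' z, ball x r x' -> norm2 z < r -> Q x' z) ->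
  exists2 r : R, 0 < r & forall x z, K x -> norm2 z <= r -> Q x z.
Proof.
move=> /compact_near_coveringP cK hQ.
pose P (r : R) x := forall z, norm2 z <= r -> Q x z.
have [|r [r0 Pr]] := @filter_ex _ (0 : R)^'+ _ [set r | 0 < r /\ K `<=` P r].
  apply: filterI; first exact: nbhs_right_gt.
  apply: (cK R (0 : R)^'+ P) => x /hQ[r r0 hr].
  exists (ball x r, [set s : R | s < r]) => /=.
    by split; [exact: nbhsx_ballx|exact: nbhs_right_lt].
  by move=> [x' s] /= [xx' sr] z zs; apply: hr => //; exact: le_lt_trans zs sr.
by exists r => // x z Kx; exact: Pr.
Qed.

Lemma compact_support_unif_continuous (K : set V) f (e : R) : compact K ->
  continuous f -> (forall x, ~ K x -> f x = 0) -> 0 < e ->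
  exists2 r : R, 0 < r & forall x z, norm2 z <= r -> `|f (x + z) - f x| <= e.
Proof.
move=> cK cf f0 e0.
have [|r r0 hr] := @compact_uniform_shift K (fun x z => `|f (x + z) - f x| <= e) cK.
  move=> x _; have : nbhs x [set y | `|f x - f y| < e / 2].
    by have /cvgrPdist_lt := cf x; apply; rewrite divr_gt0.
  move=> /nbhs_shift[r r0 hr]; exists r => // x' z xx' zr.
  have [/= h1 h2] := hr x' z xx' zr.
  by move: h1 h2; rewrite !ltr_norml ler_norml; lra.
exists r => // x z zr; have [Kx|nKx] := pselect (K x); first exact: hr.
have [Kxz|nKxz] := pselect (K (x + z)); last by rewrite !f0// subrr normr0 ltW.
(* Only the far endpoint lies in [K]: the estimate is used from there with the step reversed. *)
have := hr (x + z) (- z) Kxz; rewrite norm2N addrK distrC; exact.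
Qed.

Lemma derive_dotv f x z : differentiable f x -> 'D_z f x = dotv (grad f x) z.
Proof.
move=> df; rewrite deriveE// {1}(row_sum_delta z) linear_sum /=.
by apply: eq_bigr => j _; rewrite linearZ /= mxE /pderiv deriveE// mulrC.
Qed.

Lemma mean_value_rV f x z : (forall y, differentiable f y) ->
  exists2 c : R, 0 <= c <= 1 & f (x + z) - f x = dotv (grad f (x + c *: z)) z.
Proof.
move=> df; pose h (t : R) := f (x + t *: z).
have hd (t : R) : is_derive t 1 h (dotv (grad f (x + t *: z)) z).
  have E : (fun s : R => s^-1 *: ((h \o shift t) (s *: (1 : R)) - h t)) =
      (fun s : R => s^-1 *: ((f \o shift (x + t *: z)) (s *: z) - f (x + t *: z))).
    apply/funext => s; rewrite /h /shift /=; congr (_ *: (f _ - _)).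
    by rewrite [s *: 1]mulr1 scalerDl addrCA.
  have dfz : derivable f (x + t *: z) z by exact: diff_derivable.
  by split; rewrite /derivable /derive E// -derive_dotv.
have ch : {within `[0, 1], continuous h}.
  apply: continuous_subspaceT => t; apply: differentiable_continuous.
  by apply/derivable1_diffP; case: (hd t).
have [c c01 hc] := MVT_segment (@ler01 R) (fun t _ => hd t) ch.
exists c; first by move: c01; rewrite in_itv.
by move: hc; rewrite /h subr0 mulr1 scale1r scale0r addr0.
Qed.

(** The mean value theorem reduces the Taylor remainder to the oscillation of the partial
    derivatives, which is uniform in the base point by compact support. *)
Lemma test_pair_smooth (Om : set V) f : Cc_infty Om f -> test_pair Om f (grad f).
Proof.
move=> [sf [K [cK KOm K0]]].
have df y : differentiable f y by exact: (sf [::]).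
have cf : continuous f by move=> y; exact: differentiable_continuous.
have cg j : continuous (pderiv j f).
  by move=> y; apply: differentiable_continuous; exact: (sf [:: j]).
have g0 x : ~ K x -> grad f x = 0.
  move=> nKx; apply/rowP => j; rewrite !mxE /pderiv.
  have oK : open (~` K).
    by apply: closed_openC; apply: compact_closed cK; exact: norm_hausdorff.
  rewrite (@near_eq_derive _ _ _ f (cst 0)); first by rewrite derive_cst.
  by apply: filterS (oK x nKx) => y /K0.
have ge0 j x : ~ K x -> pderiv j f x = 0.
  by move=> /g0 /rowP /(_ j); rewrite !mxE.
split.
- split; first exact: continuous_measurable_rV.
  apply: measurable_fun_rV => j; rewrite (_ : (fun _ => _) = pderiv j f).
    exact: continuous_measurable_rV.
  by apply/funext => x; rewrite mxE.
- exists K; split => // x nKx; split; [exact: K0|exact: g0].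
- pose h x := \sum_j pderiv j f x ^+ 2.
  have ch : continuous h.
    apply: continuous_big => [|j _]; first exact: add_continuous.
    by move=> x; exact: (continuous_comp (cg j x) (@exprn_continuous R 2 _)).
  have : compact (h @` K) by apply: continuous_compact cK; exact: continuous_subspaceT.
  move=> /compact_bounded [M [_ hM]].
  have {}hM := hM _ (ltr_pwDr ltr01 (lexx M)).
  exists (Num.sqrt `|M + 1|) => x.
  have [Kx|/g0 ->] := pselect (K x); last by rewrite norm2_0 sqrtr_ge0.
  rewrite ler_wsqrtr//; apply: le_trans (ler_norm _); apply: le_trans (hM (h x) _).
    rewrite -[leLHS]ger0_norm; last by apply: sumr_ge0 => j _; rewrite sqr_ge0.
    by rewrite le_eqVlt /h; apply/orP; left; apply/eqP; congr `|_|; apply: eq_bigr => j _; rewrite mxE.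
  by exists x.
- move=> e e0.
  (* The remainder is a sum of [d] terms; the [+ 1] keeps the divisor positive. *)
  have e0' : 0 < e / (d%:R + 1) by rewrite divr_gt0// ltr_wpDl.
  have /boolp.choice[r hr] : forall j : 'I_d, exists r : R, 0 < r /\ forall x z, norm2 z <= r ->
      `|pderiv j f (x + z) - pderiv j f x| <= e / (d%:R + 1).
    move=> j; have [r r0 hr] := compact_support_unif_continuous cK (cg j) (ge0 j) e0'.
    by exists r.
  pose s := \big[Num.min/1]_j r j.
  have s0 : 0 < s by apply: lt_bigmin => // j _; have [] := hr j.
  exists s => // x z zs; have [c /andP[c0 c1] ->] := mean_value_rV x z df.
  rewrite -dotvBl.
  apply: le_trans (ler_norm_sum _ _ _) _.
  apply: (@le_trans _ _ (\sum_(j < d) e / (d%:R + 1) * norm2 z)).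
    apply: ler_sum => j _; rewrite normrM !mxE ler_pM// ?coord_le_norm2//.
    apply: (hr j).2; rewrite norm2Z ger0_norm//.
    apply: le_trans (le_trans zs _); first by rewrite ler_piMl ?norm2_ge0.
    by apply: bigmin_le_cond.
  rewrite sumr_const card_ord -mulrnAl ler_wpM2r ?norm2_ge0//.
  rewrite -mulr_natr mulrAC ler_pdivrMr ?ltr_wpDl// ler_wpM2l ?(ltW e0)//.
  by rewrite lerDl.
Qed.

End smooth_test_functions.

(** * Closedness and inradius of polytopes *)

Section polytopes.
Variables (R : realType) (d : nat).
Notation V := 'rV[R]_d.

(** The polytope is the continuous image of the compact simplex [S] of barycentric weights. *)
Lemma polytope_closed (P : set V) : polytope P -> closed P.
Proof.
move=> [m [p ->]].
pose S := [set v : 'rV[R]_m | forall i, `[0 : R, 1]%classic (v ord0 i)] `&`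
   (fun v : 'rV[R]_m => \sum_j v ord0 j) @^-1` [set 1].
pose h (v : 'rV[R]_m) : V := \sum_j v ord0 j *: p j.
have cS : compact S.
  apply: compact_closedI.
    by apply: (@rV_compact R m (fun=> `[0 : R, 1]%classic)) => i; exact: segment_compact.
  apply: preimage_closed; last exact: closed_eq.
  have cs : continuous (fun v : 'rV[R]_m => \sum_j v ord0 j).
    apply: continuous_big => [|j _]; first exact: add_continuous.
    exact: coord_continuous.
  by move=> v _; exact: cs.
have ch : continuous h.
  apply: continuous_big => [|j _]; first exact: add_continuous.
  move=> v; exact: (continuous_comp (@coord_continuous R 1 m ord0 j v)
    (@scalel_continuous _ _ (p j) _)).
rewrite (_ : [set _ | _] = h @` S).
  apply: compact_closed; first exact: norm_hausdorff.
  by apply: continuous_compact cS; exact: continuous_subspaceT.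
apply/seteqP; split=> [y [w [w0 w1 ->]]|_ [v [/= v01 v1] <-]].
  exists (\row_j w j); last by apply: eq_bigr => j _; rewrite mxE.
  split => /=; last by rewrite -w1; apply: eq_bigr => j _; rewrite mxE.
  move=> j; rewrite mxE in_itv/= w0 -w1 (bigD1 j)//= lerDl.
  by apply: sumr_ge0.
exists (fun j => v ord0 j); split => // j.
by have := v01 j; rewrite in_itv/= => /andP[].
Qed.

Lemma inradius_ge0 (P : set V) x : 0 <= inradius P x.
Proof.
have [[[r Pr] bP]|/sup_out h] := pselect (has_sup [set r : R | 0 <= r /\ cball2 x r `<=` P]).
  by apply: le_trans (_ : 0 <= r) _; [case: Pr|exact: (sup_upper_bound (conj (ex_intro _ r Pr) bP))].
by rewrite /inradius h.
Qed.

(* When no ball around x fits in P, [inradius P x] is the junk value [sup set0 = 0];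
   the hypothesis y != x excludes that case. *)
Lemma mem_polytope_inradius (P : set V) x y : polytope P -> y != x ->
  norm2 (y - x) <= inradius P x -> P y.
Proof.
move=> /polytope_closed cP yx yr.
have n0 : 0 < norm2 (y - x).
  rewrite lt_neqAle norm2_ge0 andbT eq_sym; apply: contra yx => /eqP n0.
  apply/eqP/rowP => j; apply/eqP; rewrite -subr_eq0 -normr_le0 -n0.
  by have := coord_le_norm2 (y - x) j; rewrite !mxE.
have hsup : has_sup [set r : R | 0 <= r /\ cball2 x r `<=` P].
  by apply: contrapT => /sup_out h; move: yr; rewrite /inradius h leNgt n0.
(* The inradius is a supremum: points strictly between [x] and [y] lie in some admissible ball, and
   closedness of [P] then reaches [y] as [t] tends to 1. *)
have inP (t : R) : 0 < t < 1 -> P (x + t *: (y - x)).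
  move=> /andP[t0 t1].
  have e0 : 0 < inradius P x - t * norm2 (y - x).
    rewrite subr_gt0; apply: lt_le_trans yr; rewrite gtr_pMl//.
  have [r [r0 rP] hr] := sup_adherent e0 hsup.
  apply: rP; rewrite /cball2 /= addrC addKr norm2Z gtr0_norm//.
  by move: hr; rewrite -/(inradius P x) subKr => /ltW.
have lim : (fun t : R => x + t *: (y - x)) t @[t --> (1 : R)^'-] --> y.
  have -> : y = x + 1 *: (y - x) by rewrite scale1r addrC subrK.
  rewrite [in X in _ --> X](_ : y = x + 1 *: (y - x)); last by rewrite scale1r addrC subrK.
  apply: cvg_at_left_filter; apply: cvgD; first exact: cvg_cst.
  exact: scalel_continuous.
apply: (closed_cvg P cP _ _ lim).
near=> t; apply: inP; apply/andP; split; near: t.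
  exact: nbhs_left_gt.
exact: nbhs_left_lt.
Unshelve. all: by end_near. Qed.

End polytopes.

(** * The lower bound and the limit *)

Section lower_bound.
Local Open Scope ereal_scope.
Variables (R : realType) (d : nat) (Om : set 'rV[R]_d).
Notation V := 'rV[R]_d.
Notation mu := (@rV_lebesgue R d).
Hypotheses (Om_open : open Om)
  (Om_bounded : exists M : R, forall x, Om x -> (norm2 x <= M)%R).
Variables (u : V -> R) (G : V -> V).
Hypothesis uG : sobolev_pair Om u G.

(** A measurable minorant of the nonlocal integrand: with both points in [Om], the inradius bound is
    available at both of them. *)
Definition local_density (k : R -> R) (p : V * V) : \bar R :=
  (\1_Om p.1 * \1_Om p.2 * (u p.2 - u p.1) ^+ 2 * k (norm2 (p.2 - p.1)%R))%:E.

Lemma measurable_indic_fun d' (T : measurableType d') (f : T -> V) (A : set V) :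
  measurable A -> measurable_fun setT f ->
  measurable_fun setT (fun t => \1_A (f t) : R).
Proof. by move=> mA mf; exact: measurableT_comp (measurable_indic mA) mf. Qed.

Lemma measurable_local_density k : measurable_fun setT k ->
  measurable_fun setT (local_density k).
Proof.
move=> mk; have [[mu_ _] _] := uG.
have mOm := open_measurable_rV Om_open.
apply/measurable_EFinP; apply: measurable_funM.
  apply: measurable_funM.
    apply: measurable_funM.
      exact: measurable_indic_fun measurable_fst.
    exact: measurable_indic_fun measurable_snd.
  apply/measurable_funX/measurable_funB.
    exact: measurableT_comp mu_ measurable_snd.
  exact: measurableT_comp mu_ measurable_fst.
apply: measurableT_comp mk _; apply: measurable_norm2.
exact: measurable_rVB.
Qed.

Lemma local_density_ge0 k p : (forall t, (0 <= k t)%R) -> 0 <= local_density k p.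
Proof. by move=> k0; rewrite lee_fin mulr_ge0// mulr_ge0 ?sqr_ge0// mulr_ge0. Qed.

Lemma test_pair_margin phi H : test_pair Om phi H -> exists2 r : R, (0 < r)%R &
  forall x z, H x <> 0%R -> (norm2 z <= r)%R -> Om x /\ Om (x + z)%R.
Proof.
move=> [_ [K [cK KOm K0]] _ _].
have [x Kx|r r0 hr] := @compact_uniform_shift R d K (fun x z => Om x /\ Om (x + z)%R) cK.
  by apply: nbhs_shift; apply: open_nbhs_nbhs; split => //; exact: KOm.
exists r => // x z Hx zr; apply: hr => //.
by apply: contrapT => /K0[].
Qed.

(** Accounts for the Taylor remainders: [d] unit moments for each base point in [Om], a set of
    finite measure. *)
Lemma radial_moment_on (g : R -> R) (b : R) :
  measurable_fun setT g -> (forall t, (0 <= g t)%R) -> mu Om <= b%:E ->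
  (forall j : 'I_d, \int[mu]_z ((z ord0 j ^+ 2 * g (norm2 z))%:E) = 1) ->
  \int[mu]_x \int[mu]_z (\1_Om x * (norm2 (z : V) ^+ 2 * g (norm2 z)))%:E
    <= (d%:R * b)%:E.
Proof.
move=> mg g0 muOm g1; have mOm := open_measurable_rV Om_open.
have mI : measurable_fun setT (fun x => (\1_Om x)%:E : \bar R).
  by apply/measurable_EFinP; exact: measurable_indic.
apply: (@le_trans _ _ (\int[mu]_x (d%:R%:E * (\1_Om x)%:E))).
  rewrite le_eqVlt; apply/orP; left; apply/eqP; apply: eq_integral => x _.
  under eq_integral do rewrite EFinM.
  rewrite ge0_integralZl_EFin.
  - by rewrite (radial_norm_moment g0 mg g1) muleC.
  - exact: measurableT.
  - by move=> z _; rewrite lee_fin mulr_ge0// sqr_ge0.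
  - apply/measurable_EFinP; apply: measurable_funM; last exact: measurable_radial.
    by apply: measurable_funX; exact: measurable_fun_norm2.
  - by rewrite indicE.
rewrite ge0_integralZl_EFin//.
by rewrite integral_indic// setIT EFinM; apply: lee_wpmul2l; rewrite ?lee_fin.
Qed.

(** Two weighted inequalities pass from the linear term to the increment of [phi] and then to that
    of [u]. The main term keeps [k]; the errors are enlarged to [g], whose moments are exactly 1, so
    their bound depends neither on [g] nor on [k]. *)
Lemma nonlocal_lower_bound phi H (e r b : R) (g k : R -> R) :
  test_pair Om phi H -> (0 < e < 1)%R ->
  \int[mu]_x (norm2 (H x - G x) ^+ 2)%:E <= (e ^+ 2)%:E ->
  (forall x z, (norm2 z <= r)%R ->
     (`|phi (x + z) - phi x - dotv (H x) z| <= e * norm2 z)%R) ->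
  (forall x z, H x <> 0%R -> (norm2 z <= r)%R -> Om x /\ Om (x + z)%R) ->
  mu Om <= b%:E -> (0 <= b)%R ->
  measurable_fun setT g -> (forall t, (0 <= g t)%R) ->
  (forall t, (r < t)%R -> g t = 0%R) ->
  (forall j : 'I_d, \int[mu]_z ((z ord0 j ^+ 2 * g (norm2 z))%:E) = 1) ->
  measurable_fun setT k -> (forall t, (0 <= k t <= g t)%R) ->
  \int[mu]_x (\sum_j (H x ord0 j ^+ 2)%:E *
      \int[mu]_z ((z ord0 j ^+ 2 * k (norm2 z))%:E)) <=
  (1 + 3 * e)%:E * \int[mu]_x \int[mu]_y local_density k (x, y) +
  (e * (4 + 2 * d%:R * b))%:E.
Proof.
move=> tp e01 HG taylor margin muOm b0 mg g0 gr g1 mk kg.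
have /andP[e0 e1] := e01; have [w1 [w2 w3]] := young_weight_bounds e01.
have [[mu_ mG] _] := uG; have [mp mH] := test_measurable tp.
have k0 t : (0 <= k t)%R by have /andP[] := kg t.
have e' : (0 <= 1 + e)%R by rewrite addr_ge0// ltW.
have ei : (0 <= 1 + e^-1)%R by rewrite addr_ge0// invr_ge0 ltW.
have s1 : (0 <= (1 + e) * (1 + e))%R := mulr_ge0 e' e'.
have s2 : (0 <= (1 + e) * (1 + e^-1))%R := mulr_ge0 e' ei.
have s3 : (0 <= (1 + e^-1) * e ^+ 2)%R := mulr_ge0 ei (sqr_ge0 e).
have mOm := open_measurable_rV Om_open.
pose w x := (phi x - u x)%R; have mw : measurable_fun setT w by exact: measurable_funB.
pose A (p : V * V) := local_density k (p.1, p.1 + p.2)%R.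
pose W (p : V * V) := (g (norm2 p.2) * (w (p.1 + p.2) - w p.1) ^+ 2)%:E.
pose E (p : V * V) := (\1_Om p.1 * (norm2 p.2 ^+ 2 * g (norm2 p.2)))%:E.
have A0 p : 0 <= A p by exact: local_density_ge0.
have W0 p : 0 <= W p by rewrite lee_fin mulr_ge0// sqr_ge0.
have E0 p : 0 <= E p by rewrite lee_fin mulr_ge0// mulr_ge0// sqr_ge0.
have mA : measurable_fun setT A.
  apply: measurableT_comp (measurable_local_density mk) _.
  apply: measurable_fun_pair; first exact: measurable_fst.
  exact: measurable_rVD.
have mW : measurable_fun setT W by exact: measurable_nonlocal.
have mE : measurable_fun setT E.
  apply/measurable_EFinP; apply: measurable_funM.
    exact: measurable_indic_fun measurable_fst.
  have mn : measurable_fun setT (fun p : V * V => norm2 p.2).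
    exact: measurable_norm2 measurable_snd.
  apply: measurable_funM; first exact: measurable_funX.
  exact: measurableT_comp mg mn.
have rhs0 x z : 0 <= ((1 + e) * (1 + e))%:E * A (x, z) +
    (((1 + e) * (1 + e^-1))%:E * W (x, z) + ((1 + e^-1) * e ^+ 2)%:E * E (x, z)).
  apply: adde_ge0; first by apply: mule_ge0 (A0 _); rewrite lee_fin; exact: s1.
  apply: adde_ge0; first by apply: mule_ge0 (W0 _); rewrite lee_fin; exact: s2.
  by apply: mule_ge0 (E0 _); rewrite lee_fin; exact: s3.
have pointwise x z : ((dotv (H x) z ^+ 2 * k (norm2 z))%:E <=
    ((1 + e) * (1 + e))%:E * A (x, z) + (((1 + e) * (1 + e^-1))%:E * W (x, z) +
    ((1 + e^-1) * e ^+ 2)%:E * E (x, z))).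
  (* The left side vanishes where the gradient does and for steps longer than [r]; otherwise the
     margin puts both points in [Om] and both indicators equal 1. *)
  have [Hx|/eqP Hx] := eqVneq (H x) 0%R.
    by rewrite Hx dotv0l expr0n /= mul0r; exact: rhs0.
  have [zr|zr] := leP (norm2 z) r; last first.
    have -> : k (norm2 z) = 0%R.
      by apply/eqP; rewrite eq_le k0 andbT -(gr _ zr); have /andP[] := kg (norm2 z).
    by rewrite mulr0; exact: rhs0.
  have [Ox Oxz] := margin x z Hx zr.
  rewrite /A /local_density /W /E /= !indicE !mem_set//= !mul1r.
  rewrite [(x + z - x)%R]addrC addKr -!EFinM -!EFinD lee_fin.
  have /andP[_ kgz] := kg (norm2 z).
  have h1 := sqr_le_weighted (dotv (H x) z) (phi (x + z) - phi x)%R e0.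
  have h2 := sqr_le_weighted (phi (x + z) - phi x)%R (u (x + z) - u x)%R e0.
  have h3 : ((dotv (H x) z - (phi (x + z) - phi x)) ^+ 2 <= e ^+ 2 * norm2 z ^+ 2)%R.
    rewrite -sqrrN opprB -exprMn -[leLHS]real_normK ?num_real//.
    by rewrite ler_pXn2r ?nnegrE ?mulr_ge0 ?norm2_ge0 ?(ltW e0)//; exact: taylor.
  have h4 : (phi (x + z) - phi x - (u (x + z) - u x) = w (x + z) - w x)%R.
    by rewrite /w; ring.
  rewrite h4 in h2.
  set D := (dotv (H x) z ^+ 2)%R in h1 *; set U := ((u (x + z) - u x) ^+ 2)%R in h2 *.
  set Ph := ((phi (x + z) - phi x) ^+ 2)%R in h1 h2.
  set X := ((w (x + z) - w x) ^+ 2)%R in h2 *; set N := (norm2 z ^+ 2)%R in h3 *.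
  have X0 : (0 <= X)%R by exact: sqr_ge0.
  have N0 : (0 <= N)%R by exact: sqr_ge0.
  have hD : (D <= (1 + e) * ((1 + e) * U + (1 + e^-1) * X) + (1 + e^-1) * (e ^+ 2 * N))%R.
    apply: le_trans h1 _; apply: lerD; first exact: ler_wpM2l.
    exact: ler_wpM2l.
  apply: le_trans (ler_wpM2r (k0 _) hD) _.
  set kz := k (norm2 z) in kgz *; set gz := g (norm2 z) in kgz *.
  rewrite [leLHS](_ : _ = (1 + e) * (1 + e) * (U * kz) + ((1 + e) * (1 + e^-1) * (kz * X)
    + (1 + e^-1) * e ^+ 2 * (N * kz)))%R; last by ring.
  rewrite lerD2l; apply: lerD; apply: ler_wpM2l.
  - exact: s2.
  - exact: ler_wpM2r.
  - exact: s3.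
  - exact: ler_wpM2l.
have inner x : \sum_j (H x ord0 j ^+ 2)%:E *
      \int[mu]_z ((z ord0 j ^+ 2 * k (norm2 z))%:E) <=
    ((1 + e) * (1 + e))%:E * \int[mu]_z A (x, z) +
    (((1 + e) * (1 + e^-1))%:E * \int[mu]_z W (x, z) +
    ((1 + e^-1) * e ^+ 2)%:E * \int[mu]_z E (x, z)).
  rewrite -(radial_second_moments k0 mk (H x)).
  apply: le_integral_comb3 => //.
  - by move=> z; rewrite lee_fin mulr_ge0// sqr_ge0.
  - exact: measurableT_comp mA (pair1_measurable x).
  - exact: measurableT_comp mW (pair1_measurable x).
  - exact: measurableT_comp mE (pair1_measurable x).
have outer : \int[mu]_x (\sum_j (H x ord0 j ^+ 2)%:E *
      \int[mu]_z ((z ord0 j ^+ 2 * k (norm2 z))%:E)) <=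
    ((1 + e) * (1 + e))%:E * \int[mu]_x \int[mu]_z A (x, z) +
    (((1 + e) * (1 + e^-1))%:E * \int[mu]_x \int[mu]_z W (x, z) +
    ((1 + e^-1) * e ^+ 2)%:E * \int[mu]_x \int[mu]_z E (x, z)).
  apply: le_integral_comb3 => //.
  - move=> x; apply: sume_ge0 => j _; rewrite mule_ge0 ?sqr_EFin_ge0//.
    by apply: integral_ge0 => z _; rewrite lee_fin mulr_ge0// sqr_ge0.
  - by move=> x; apply: integral_ge0.
  - by move=> x; apply: integral_ge0.
  - by move=> x; apply: integral_ge0.
  - exact: measurable_rV_integral.
  - exact: measurable_rV_integral.
  - exact: measurable_rV_integral.
clear pointwise inner; have intA : \int[mu]_x \int[mu]_z A (x, z) =
    \int[mu]_x \int[mu]_y local_density k (x, y).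
  apply: eq_integral => x _.
  rewrite -(rV_integral_shift x (f := fun y => local_density k (x, y))).
  - by apply: eq_integral => z _; rewrite /A /= addrC.
  - by move=> y; exact: local_density_ge0.
  - exact: measurableT_comp (measurable_local_density mk) (pair1_measurable x).
(* The upper bound for the pair [(phi - u, H - G)]. *)
have intW : \int[mu]_x \int[mu]_z W (x, z) <= (e ^+ 2)%:E.
  apply: le_trans HG; have sp := sobolev_pair_subl tp uG.
  apply: le_trans (sobolev_pair_nonlocal Om_bounded sp g0 mg g1).
  rewrite le_eqVlt; apply/orP; left; apply/eqP.
  by apply: eq_integral => x _; rewrite (nonlocal_shift _ g0 mw mg).
have intE : \int[mu]_x \int[mu]_z E (x, z) <= (d%:R * b)%:E.
  exact: radial_moment_on.
apply: le_trans outer _; rewrite intA; apply: leeD.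
  apply: lee_wpmul2r; last by rewrite lee_fin.
  by apply: integral_ge0 => x _; apply: integral_ge0 => y _; exact: local_density_ge0.
(* In the final error, [4 e] comes from the increments of [phi - u] and [2 e d b] from the Taylor
   remainders. *)
apply: (@le_trans _ _ (((1 + e) * (1 + e^-1))%:E * (e ^+ 2)%:E +
    ((1 + e^-1) * e ^+ 2)%:E * (d%:R * b)%:E)).
  apply: leeD.
    by apply: lee_wpmul2l intW; rewrite lee_fin; exact: s2.
  by apply: lee_wpmul2l intE; rewrite lee_fin; exact: s3.
rewrite -!EFinM -EFinD lee_fin.
rewrite [leRHS](_ : _ = 4 * e + 2 * e * (d%:R * b))%R; last by ring.
apply: lerD; first by rewrite -mulrA; exact: w2.
by apply: ler_wpM2r; [rewrite mulr_ge0|exact: w3].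
Qed.

Lemma sobolev_pair_energy_fin : \int[mu]_x (norm2 (G x) ^+ 2)%:E < +oo.
Proof.
have [[mu_ mG] ap] := uG; have [phi [H [tp _ h]]] := ap 1%R ltr01.
have [[_ mH] [K [_ KOm K0]] [B hB] _] := tp.
have mOm := open_measurable_rV Om_open.
have [M hM] := Om_bounded.
have muOm : mu Om < +oo.
  apply: (@rV_lebesgue_bounded _ _ _ M) => // x Ox j.
  exact: le_trans (coord_le_norm2 _ _) (hM _ Ox).
have mHG : measurable_fun setT (fun x => H x - G x)%R by exact: measurable_rVB.
apply: (@le_lt_trans _ _ ((2 * B ^+ 2)%:E * \int[mu]_x (\1_Om x)%:E +
    2%:E * \int[mu]_x (norm2 (H x - G x)%R ^+ 2)%:E)).
  apply: le_integral_comb => //.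
  - by rewrite mulr_ge0// sqr_ge0.
  - by move=> x; exact: sqr_EFin_ge0.
  - by move=> x; exact: sqr_EFin_ge0.
  - by apply/measurable_EFinP; exact: measurable_indic.
  - exact: (measurable_sqr_norm2 mHG).
  move=> x; rewrite -!EFinM -EFinD lee_fin.
  rewrite [X in (norm2 X ^+ 2 <= _)%R](_ : G x = H x - (H x - G x))%R; last first.
    by rewrite opprB addrC subrK.
  apply: le_trans (norm2_sqrB_le _ _) _; rewrite lerD2r -mulrA ler_wpM2l//.
  have B0 : (0 <= B)%R by exact: le_trans (norm2_ge0 _) (hB 0%R).
  rewrite indicE; have [xO|xO] := boolP (x \in Om).
    by rewrite mulr1 ler_pXn2r ?nnegrE ?norm2_ge0.
  rewrite mulr0 (K0 x _).2 ?norm2_0 ?expr0n//.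
  by move=> /KOm Ox; rewrite mem_set in xO.
rewrite integral_indic// setIT lte_add_pinfty//.
  by rewrite lte_mul_pinfty// lee_fin mulr_ge0// sqr_ge0.
by rewrite lte_mul_pinfty// ?lee_fin// (le_lt_trans h)// ltry.
Qed.

End lower_bound.

(** * Extension by zero of functions of H^1_0 *)

Section zero_extension.
Local Open Scope ereal_scope.
Variables (R : realType) (d : nat) (Om : set 'rV[R]_d).
Notation V := 'rV[R]_d.
Notation mu := (@rV_lebesgue R d).
Hypothesis Om_open : open Om.

Definition zero_ext (g : V -> V) (x : V) : V := if `[< Om x >] then g x else 0%R.

Lemma zero_extT g x : Om x -> zero_ext g x = g x.
Proof. by move=> Ox; rewrite /zero_ext asboolT. Qed.

Lemma zero_extF g x : ~ Om x -> zero_ext g x = 0%R.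
Proof. by move=> Ox; rewrite /zero_ext asboolF. Qed.

Lemma measurable_zero_ext (g : V -> V) : (forall i : 'I_d, borel_fun (fun x => g x ord0 i)) ->
  measurable_fun setT (zero_ext g).
Proof.
move=> bg; apply: measurable_fun_rV => j.
rewrite (_ : (fun _ => _) = fun x => (\1_Om x * g x ord0 j)%R).
  apply: measurable_funM; last exact: borel_fun_measurable.
  by apply: measurable_indic; exact: open_measurable_rV.
apply/funext => x; rewrite indicE /zero_ext; case: asboolP => Ox.
  by rewrite mem_set// mul1r.
by rewrite memNset// mul0r mxE.
Qed.

Lemma cvg0_exists_le (a b : nat -> \bar R) (e : R) : (0 < e)%R ->
  a @ \oo --> 0%E -> b @ \oo --> 0%E -> exists n, a n <= e%:E /\ b n <= e%:E.
Proof.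
move=> e0 a0 b0.
have nb : nbhs (0 : \bar R) [set y | y < e%:E].
  by apply: open_nbhs_nbhs; split; [exact: open_ereal_lt_ereal|rewrite /= lte_fin].
have : \forall n \near \oo, a n < e%:E /\ b n < e%:E.
  by apply: filterI; [exact: a0 nb|exact: b0 nb].
by move=> /filter_ex[n [/ltW ? /ltW ?]]; exists n.
Qed.

(** Approximants and extensions all vanish outside [Om], so convergence over [Om] is convergence
    over the whole space. *)
Lemma H10_sobolev_pair (u : V -> R) (g : V -> V) : borel_fun u ->
  (forall i : 'I_d, borel_fun (fun x => g x ord0 i)) ->
  (forall x, ~ Om x -> u x = 0%R) -> H10 Om u g -> sobolev_pair Om u (zero_ext g).
Proof.
move=> bu bg u0 [phi [sphi [cv1 cv2]]].
have mu_ := borel_fun_measurable bu; have mG := measurable_zero_ext bg.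
split=> // e e0; have [n [h1 h2]] := cvg0_exists_le e0 cv1 cv2.
have tp := test_pair_smooth (sphi n).
have [[mp mH] [K [_ KOm K0]] _ _] := tp.
exists (phi n), (grad (phi n)); split => //.
- rewrite -intRdE; first last.
  + by apply/measurable_EFinP/measurable_funX/measurable_funB.
  + by move=> x; exact: sqr_EFin_ge0.
  apply: le_trans h1; apply: le_iint => x; first exact: sqr_EFin_ge0.
  case: asboolP => // Ox; rewrite u0// (K0 x _).1; last by move/KOm.
  by rewrite subrr expr0n.
- rewrite -intRdE; first last.
  + apply/measurable_EFinP/measurable_funX; apply: measurable_norm2.
    exact: measurable_rVB.
  + by move=> x; exact: sqr_EFin_ge0.
  apply: le_trans h2; apply: le_iint => x; first exact: sqr_EFin_ge0.
  case: asboolP => Ox; first by rewrite zero_extT.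
  rewrite zero_extF// (K0 x _).2; last by move/KOm.
  by rewrite subrr norm2_0 expr0n.
Qed.

End zero_extension.

Lemma squeeze_cvg (R : realType) (F : nat -> \bar R) (I : R) (C : R) : 0 <= C ->
  (forall k, (0 <= F k <= I%:E)%E) ->
  (forall e : R, 0 < e < 1 -> \forall k \near \oo, (I%:E <= F k + (C * e)%:E)%E) ->
  F @ \oo --> I%:E.
Proof.
move=> C0 FI h; apply/fine_cvgP; split.
  apply: nearW => k; have /andP[F0 F1] := FI k.
  by rewrite ge0_fin_numE// (le_lt_trans F1)// ltry.
apply/cvgrPdist_le => e e0.
pose e' := Num.min 2^-1 (e / (C + 1)).
have C1 : 0 < C + 1 by rewrite ltr_wpDl.
have e'0 : 0 < e' by rewrite lt_min invr_gt0 ltr0n divr_gt0.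
have e'1 : 0 < e' < 1 by rewrite e'0 gt_min invf_lt1 ?ltr1n.
have Ce : C * e' <= e.
  apply: (@le_trans _ _ ((C + 1) * e')); first by rewrite ler_wpM2r ?(ltW e'0)// lerDl.
  by rewrite mulrC -ler_pdivlMr// ge_min lexx orbT.
near=> k.
have : (I%:E <= F k + (C * e')%:E)%E by near: k; exact: h.
have := FI k; rewrite /comp; case: (F k) => [f| |] //= /andP[f0 fI].
  rewrite lee_fin in fI; rewrite -EFinD lee_fin => fe.
  by rewrite ger0_norm ?subr_ge0//; lra.
Unshelve. all: by end_near. Qed.

(** * Passage to the limit *)

Section convergence.
Local Open Scope ereal_scope.
Variables (R : realType) (d : nat) (Om : set 'rV[R]_d).
Notation V := 'rV[R]_d.
Notation mu := (@rV_lebesgue R d).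
Hypotheses (Om_open : open Om)
  (Om_bounded : exists M : R, forall x, Om x -> (norm2 x <= M)%R).
Variables (u : V -> R) (G : V -> V).
Hypothesis uG : sobolev_pair Om u G.
Variables (delta : nat -> R) (g k : nat -> R -> R).
Hypotheses (delta0 : delta @ \oo --> (0 : R)%R)
  (mg : forall n, measurable_fun setT (g n)) (g0 : forall n t, (0 <= g n t)%R)
  (gd : forall n t, (delta n < t)%R -> g n t = 0%R)
  (g1 : forall n (j : 'I_d), \int[mu]_z ((z ord0 j ^+ 2 * g n (norm2 z))%:E) = 1)
  (mk : forall n, measurable_fun setT (k n))
  (kg : forall n t, (0 <= k n t <= g n t)%R)
  (k1 : forall j : 'I_d,
    (fun n => \int[mu]_z ((z ord0 j ^+ 2 * k n (norm2 z))%:E)) @ \oo --> 1).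

Let I := fine (\int[mu]_x (norm2 (G x) ^+ 2)%:E).

Lemma energy_fineE : \int[mu]_x (norm2 (G x) ^+ 2)%:E = I%:E.
Proof.
have E0 : 0 <= \int[mu]_x (norm2 (G x) ^+ 2)%:E.
  by apply: integral_ge0 => x _; exact: sqr_EFin_ge0.
rewrite /I fineK// ge0_fin_numE//.
exact: (sobolev_pair_energy_fin Om_open Om_bounded uG).
Qed.

Lemma moments_eventually (e : R) : (0 < e)%R -> \forall n \near \oo,
  forall j : 'I_d, (1 - e)%:E <= \int[mu]_z ((z ord0 j ^+ 2 * k n (norm2 z))%:E).
Proof.
move=> e0; apply: filter_forall => j.
have nb : nbhs (1 : \bar R) [set y | (1 - e)%:E < y].
  apply: open_nbhs_nbhs; split; first exact: open_ereal_gt_ereal.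
  by rewrite /= lte_fin ltrBlDr ltrDl.
near=> n; apply: ltW; near: n; exact: (@k1 j _ nb).
Unshelve. all: by end_near. Qed.

(** [F] enters only through two measurable comparison energies, which keeps the polytopes out of the
    limit argument. *)
Lemma nonlocal_energy_cvg (F : nat -> \bar R) :
  (forall n, F n <= \int[mu]_x \int[mu]_y
     ((u y - u x) ^+ 2 * g n (norm2 (y - x)%R))%:E) ->
  (forall n, \int[mu]_x \int[mu]_y local_density Om u (k n) (x, y) <= F n) ->
  F @ \oo --> \int[mu]_x (norm2 (G x) ^+ 2)%:E.
Proof.
move=> Fub Flb; rewrite energy_fineE.
have mOm := open_measurable_rV Om_open.
have k0 n t : (0 <= k n t)%R by have /andP[] := kg n t.
have [M hM] := Om_bounded.
have muOm : mu Om < +oo.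
  apply: (@rV_lebesgue_bounded _ _ _ M) => // x Ox j.
  exact: le_trans (coord_le_norm2 _ _) (hM _ Ox).
pose b := fine (mu Om).
have b0 : (0 <= b)%R by exact: fine_ge0.
have bE : mu Om <= b%:E by rewrite /b fineK// ge0_fin_numE.
have I0 : (0 <= I)%R.
  by apply: fine_ge0; apply: integral_ge0 => x _; exact: sqr_EFin_ge0.
have FI n : 0 <= F n <= I%:E.
  apply/andP; split.
    apply: le_trans (Flb n); apply: integral_ge0 => x _; apply: integral_ge0 => y _.
    exact: local_density_ge0.
  rewrite -energy_fineE; apply: le_trans (Fub n) _.
  exact: (sobolev_pair_nonlocal Om_bounded uG (g0 n) (mg n) (g1 n)).
pose c := (4 + 2 * d%:R * b)%R.
have c0 : (0 <= c)%R by rewrite addr_ge0// mulr_ge0// mulr_ge0.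
(* One [I] comes from the factor [1 - e] and seven from [(1 + e) (1 + 3 e) <= 1 + 7 e] with
   [F n <= I]; [2 c] is the error of the lower bound, and the last [2] the cost of replacing [G] by
   [H]. *)
apply: (@squeeze_cvg _ F I (8 * I + 2 * c + 2)%R) => //.
  by rewrite !addr_ge0// mulr_ge0.
move=> e e01; have /andP[e0 e1] := e01.
have [w1 [w2 w3]] := young_weight_bounds e01.
have [[mu_ mG] ap] := uG.
have [phi [H [tp _ HG]]] := ap (e ^+ 2)%R (exprn_gt0 _ e0).
have [_ mH] := test_measurable tp.
have [r r0 taylor] := test_taylor tp e0.
have [s s0 margin] := test_pair_margin Om_open tp.
pose h := \int[mu]_x (norm2 (H x) ^+ 2)%:E.
have h0 : 0 <= h by apply: integral_ge0 => x _; exact: sqr_EFin_ge0.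
have mHG : measurable_fun setT (fun x => H x - G x)%R by exact: measurable_rVB.
have e' : (0 <= 1 + e)%R by rewrite addr_ge0// ltW.
have ei : (0 <= 1 + e^-1)%R by rewrite addr_ge0// invr_ge0 ltW.
have Ih : I%:E <= (1 + e)%:E * h + (2 * e)%:E.
  rewrite -energy_fineE.
  apply: (@le_trans _ _ ((1 + e)%:E * h +
      (1 + e^-1)%:E * \int[mu]_x (norm2 (H x - G x)%R ^+ 2)%:E)).
    apply: le_integral_comb => //; try by move=> x; exact: sqr_EFin_ge0.
    - exact: measurable_sqr_norm2.
    - exact: (measurable_sqr_norm2 mHG).
    move=> x; rewrite -!EFinM -EFinD lee_fin !sqr_norm2 !mulr_sumr -big_split /=.
    apply: ler_sum => j _; rewrite !mxE -[X in (_ <= _ + _ * X)%R]sqrrN opprB.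
    exact: sqr_le_weighted.
  apply: leeD => //; apply: (@le_trans _ _ ((1 + e^-1)%:E * (e ^+ 2)%:E)).
    by apply: lee_wpmul2l; rewrite ?lee_fin.
  by rewrite -EFinM lee_fin.
have rs0 : (0 < Num.min r s)%R by rewrite lt_min r0.
have near_d : \forall n \near \oo, (delta n < Num.min r s)%R.
  exact: (@cvgr_lt _ _ _ _ _ _ delta0).
have near_m := moments_eventually e0.
near=> n.
have dn : (delta n < Num.min r s)%R by near: n.
have mn : forall j : 'I_d, (1 - e)%:E <= \int[mu]_z ((z ord0 j ^+ 2 * k n (norm2 z))%:E).
  by near: n.
have LB := @nonlocal_lower_bound _ _ Om Om_open Om_bounded u G uG phi H e
  (Num.min r s) b (g n) (k n) tp e01 HG.
have {}LB : (1 - e)%:E * h <= (1 + 3 * e)%:E * F n + (e * c)%:E.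
  apply: (@le_trans _ _ (\int[mu]_x (\sum_j (H x ord0 j ^+ 2)%:E *
      \int[mu]_z ((z ord0 j ^+ 2 * k n (norm2 z))%:E)))).
    rewrite -ge0_integralZl_EFin; first last.
    - by rewrite subr_ge0 ltW.
    - exact: measurable_sqr_norm2.
    - by move=> x _; exact: sqr_EFin_ge0.
    - exact: measurableT.
    apply: le_nnintegral => x.
      by rewrite mule_ge0 ?sqr_EFin_ge0// lee_fin subr_ge0 ltW.
    rewrite muleC sqr_norm2 -sumEFin ge0_sume_distrl; last first.
      by move=> j _; exact: sqr_EFin_ge0.
    by apply: lee_sum => j _; apply: lee_wpmul2l; [exact: sqr_EFin_ge0|exact: mn].
  apply: le_trans (LB _ _ bE b0 (mg n) (g0 n) _ (g1 n) (mk n) (kg n)) _.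
  - by move=> x z; rewrite le_min => /andP[zr _]; exact: taylor.
  - by move=> x z Hx; rewrite le_min => /andP[_ zs]; exact: margin.
  - by move=> t dt; apply: gd; exact: lt_trans dn dt.
  apply: leeD => //; apply: lee_wpmul2l; last exact: Flb.
  by rewrite lee_fin addr_ge0// mulr_ge0// ltW.
have := FI n; move: LB; case: (F n) => [f| |] //=; last first.
  by move=> _; rewrite leye_eq => /andP[].
rewrite -EFinM -EFinD => LB /andP[]; rewrite !lee_fin => f0 fI.
move: h h0 Ih LB => [h| |] //; last first.
  by move=> _ _; rewrite gt0_muley ?lte_fin ?subr_gt0// leye_eq.
rewrite -!EFinM -!EFinD !lee_fin => h0 Ih LB.
have e00 : (0 <= e)%R by exact: ltW.
have a1 : ((1 - e) * I <= (1 + e) * ((1 - e) * h) + 2 * e)%R by nra.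
have a2 : ((1 + e) * ((1 - e) * h) <= (1 + e) * ((1 + 3 * e) * f + e * c))%R.
  exact: ler_wpM2l.
have a3 : (e * e <= e)%R by nra.
have a4 : (e * e * f <= e * I)%R by nra.
have a5 : (e * e * c <= e * c)%R by exact: ler_wpM2r.
have a6 : (e * f <= e * I)%R by exact: ler_wpM2l.
nra.
Unshelve. all: by end_near. Qed.

End convergence.

(** * Comparison of the truncated kernel with radial kernels *)

Section truncated_kernel.
Local Open Scope ereal_scope.
Variables (R : realType) (d : nat) (gt : R -> R).
Notation V := 'rV[R]_d.
Notation mu := (@rV_lebesgue R d).
Hypotheses (mgt : measurable_fun setT gt) (gt0 : forall t, (0 <= gt t)%R).

Definition cut (r t : R) : R := if (t <= r)%R then gt t else 0%R.

Lemma measurable_cut r : measurable_fun setT (cut r).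
Proof.
by apply: measurable_fun_if => //; [exact: measurable_fun_ler|exact: measurable_funTS].
Qed.

Lemma cut_ge0_le r t : (0 <= cut r t <= gt t)%R.
Proof. by rewrite /cut; case: ifP => _; rewrite ?gt0 ?lexx. Qed.

Lemma second_momentE (f : R -> R) j : measurable_fun setT f ->
  (forall t, (0 <= f t)%R) ->
  intRd (fun z : V => ((z ord0 j) ^+ 2 * f (norm2 z))%:E) =
  \int[mu]_z ((z ord0 j ^+ 2 * f (norm2 z))%:E).
Proof.
move=> mf f0; rewrite intRdE//.
  by move=> z; rewrite lee_fin mulr_ge0// sqr_ge0.
apply/measurable_EFinP; apply: measurable_funM; last exact: measurable_radial.
by apply: measurable_funX; exact: measurable_coord.
Qed.

Lemma intOn_cball2_cut r j :
  intOn (cball2 0 r) (fun z : V => ((z ord0 j) ^+ 2 * gt (norm2 z))%:E) =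
  \int[mu]_z ((z ord0 j ^+ 2 * cut r (norm2 z))%:E).
Proof.
rewrite -second_momentE; first last.
- by move=> t; have /andP[] := cut_ge0_le r t.
- exact: measurable_cut.
congr intRd; apply/funext => z; rewrite /cball2 /cut /= subr0.
by case: asboolP => [->//|/negP/negbTE ->]; rewrite mulr0.
Qed.

Lemma gamma_sym_le (P : V -> set V) x y : (gamma_sym gt P x y <= gt (norm2 (y - x)))%R.
Proof.
have h (a b : V) : (gamma_trunc gt P a b <= gt (norm2 (b - a)))%R.
  by rewrite /gamma_trunc; case: asboolP.
rewrite /gamma_sym; have := h x y; have := h y x.
by rewrite -[in X in X -> _]norm2N opprB; lra.
Qed.

Lemma gamma_sym_ge0 (P : V -> set V) x y : (0 <= gamma_sym gt P x y)%R.
Proof.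
have h (a b : V) : (0 <= gamma_trunc gt P a b)%R.
  by rewrite /gamma_trunc; case: asboolP.
by rewrite /gamma_sym divr_ge0// addr_ge0.
Qed.

End truncated_kernel.

Theorem theoremA3 (R : realType) (d : nat) (Om : set 'rV[R]_d)
    (delta : nat -> R) (delta0 : R)
    (gt : nat -> R -> R) (P : nat -> 'rV[R]_d -> set 'rV[R]_d)
    (u : 'rV[R]_d -> R) (g : 'rV[R]_d -> 'rV[R]_d) :
  (0 < d)%N ->
  open Om ->
  (exists M : R, forall x, Om x -> norm2 x <= M) ->
  (* the sequence delta_k *)
  (forall k, 0 < delta k) ->
  (forall k, delta k.+1 < delta k) ->
  delta @ \oo --> (0 : R) ->
  (forall k, delta k <= delta0) ->
  (* kernels gamma_{delta_k}(x,y) = gt k (||y - x||_2) *)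
  (forall k, measurable_fun setT (gt k)) ->
  (forall k t, 0 <= gt k t) ->
  (forall k t, 0 <= t < delta k -> 0 < gt k t) ->
  (forall k t, delta k < t -> gt k t = 0) ->
  (forall k (i : 'I_d),
      intOn (cball2 0 (delta k))
        (fun z => ((z ord0 i) ^+ 2 * gt k (norm2 z))%:E) = 1%E) ->
  (* polytopes B_{delta_k, n_{delta_k,x}}(x) *)
  (forall k x, polytope (P k x)) ->
  (forall k x, P k x `<=` cball2 x (delta k)) ->
  (* assumption on underline r(n_{delta_k}) = inf_{x in Om} r_{delta_k,x} *)
  (forall i : 'I_d,
      (fun k => intOn
         (cball2 0 (inf [set inradius (P k x) x | x in Om]))
         (fun z => ((z ord0 i) ^+ 2 * gt k (norm2 z))%:E)) @ \oo --> 1%E) ->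
  (* u is the extension by zero of a function of H^1_0(Om), with gradient g *)
  borel_fun u ->
  (forall i : 'I_d, borel_fun (fun x => g x ord0 i)) ->
  (forall x, ~ Om x -> u x = 0) ->
  H10 Om u g ->
  let D := Om `|` [set y | ~ Om y /\ dist2 y (bdry Om) < delta0] in
  let gradu := fun x => if `[< Om x >] then g x else 0 in
  (fun k => intOn D (fun x => intOn D (fun y =>
      ((u y - u x) ^+ 2 * gamma_sym (gt k) (P k) x y)%:E)))
    @ \oo --> intOn D (fun x => ((norm2 (gradu x)) ^+ 2)%:E).

Proof.
(* The polytopes may depend on x in a nonmeasurable way, so the double integral
   is an iterated lower integral: it is only ever compared, by monotonicity,
   with integrals of measurable kernels. *)
move=> _ oOm bOm _ _ cvd _ mgt gt0 _ gtd gt1 polyP _ cvm bu bg u0 h10 D gradu.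
have uG := H10_sobolev_pair oOm bu bg u0 h10.
have [[mu_ mG] _] := uG.
pose r k := inf [set inradius (P k x) x | x in Om].
have DOm x : Om x -> D x by left.
have -> : intOn D (fun x => ((norm2 (gradu x)) ^+ 2)%:E) =
    (\int[@rV_lebesgue R d]_x (norm2 (zero_ext Om g x) ^+ 2)%:E)%E.
  rewrite -intRdE; first last.
  - exact: measurable_sqr_norm2.
  - by move=> x; exact: sqr_EFin_ge0.
  congr intRd; apply/funext => x; case: asboolP => // Dx.
  by rewrite zero_extF ?norm2_0 ?expr0n// => /DOm.
(* The kernel vanishes beyond [delta k], so the normalization over the ball is one over the whole
   space. *)
have gt_moment k j : (\int[@rV_lebesgue R d]_z ((z ord0 j ^+ 2 * gt k (norm2 z))%:E) = 1)%E.
  rewrite -second_momentE// -(gt1 k j) /intOn; congr intRd; apply/funext => z.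
  rewrite /cball2 /= subr0; case: asboolP => // /negP; rewrite -ltNge => /gtd ->.
  by rewrite mulr0.
have cut0 k t : 0 <= cut (gt k) (r k) t by have /andP[] := cut_ge0_le (gt0 k) (r k) t.
apply: (nonlocal_energy_cvg oOm bOm uG (k := fun k => cut (gt k) (r k))
  cvd mgt gt0 gtd gt_moment).
- by move=> k; exact: measurable_cut.
- by move=> k t; exact: cut_ge0_le.
- by move=> j; under eq_fun do rewrite -intOn_cball2_cut//; exact: cvm.
- move=> k.
  have mk2 : measurable_fun setT (fun p : 'rV[R]_d * 'rV[R]_d =>
      ((u p.2 - u p.1) ^+ 2 * gt k (norm2 (p.2 - p.1)))%:E).
    apply/measurable_EFinP; apply: measurable_funM.
      by apply/measurable_funX/measurable_funB;
        [exact: measurableT_comp mu_ measurable_snd|exact: measurableT_comp mu_ measurable_fst].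
    apply: measurableT_comp (mgt k) _; apply: measurable_norm2; exact: measurable_rVB.
  have k20 p : (0 <= ((u p.2 - u p.1) ^+ 2 * gt k (norm2 (p.2 - p.1)))%:E)%E.
    by rewrite lee_fin mulr_ge0// sqr_ge0.
  have q0 x y : (0 <= (if `[< D y >] then
      ((u y - u x) ^+ 2 * gamma_sym (gt k) (P k) x y)%:E else 0))%E.
    by case: asboolP => // _; rewrite lee_fin mulr_ge0 ?sqr_ge0// gamma_sym_ge0.
  rewrite -intRdE; first last.
  + exact: (measurable_rV_integral k20 mk2).
  + by move=> x; apply: integral_ge0 => y _; exact: (k20 (x, y)).
  apply: le_iint => x; first by case: asboolP => // _; exact: iint_ge0 (q0 x).
  rewrite -intRdE; first last.
  + exact: measurableT_comp mk2 (pair1_measurable x).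
  + by move=> y; exact: (k20 (x, y)).
  case: asboolP => _; last by apply: iint_ge0 => y; exact: (k20 (x, y)).
  apply: le_iint => y; first exact: q0.
  case: asboolP => _; last exact: (k20 (x, y)).
  by rewrite lee_fin ler_wpM2l ?sqr_ge0// gamma_sym_le.
move=> k.
have ml := measurable_local_density oOm uG (measurable_cut (mgt k) (r k)).
have l0 p : (0 <= local_density Om u (cut (gt k) (r k)) p)%E.
  by apply: local_density_ge0 => t; exact: cut0.
rewrite -intRdE; first last.
- exact: (measurable_rV_integral l0 ml).
- by move=> x; apply: integral_ge0.
apply: le_iint => x; first by apply: integral_ge0.
rewrite -intRdE; first last.
- exact: measurableT_comp ml (pair1_measurable x).
- by [].
have g_ge0 y : (0 <= ((u y - u x) ^+ 2 * gamma_sym (gt k) (P k) x y)%:E)%E.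
  by rewrite lee_fin mulr_ge0 ?sqr_ge0// gamma_sym_ge0.
have [Ox|nOx] := pselect (Om x); last first.
  rewrite (_ : (fun y => _) = fun=> 0%E); last first.
    by apply/funext => y; rewrite /local_density /= indicE memNset// !mul0r.
  apply: (@le_trans _ _ 0%E); last first.
    case: asboolP => // _; apply: iint_ge0 => y; by case: asboolP.
  rewrite intRdE//; first by rewrite integral0.
rewrite asboolT; last exact: DOm.
apply: le_iint => y //.
have [Oy|nOy] := pselect (Om y); last first.
  rewrite /local_density /= [\1_Om y]indicE memNset// mulr0 !mul0r.
  by case: asboolP.
rewrite asboolT; last exact: DOm.
rewrite /local_density /= !indicE !mem_set// !mul1r lee_fin.
(* On the diagonal the increment is zero; off it, [mem_polytope_inradius] applies. *)
have [->|yx] := eqVneq y x; first by rewrite subrr expr0n /= !mul0r.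
apply: ler_wpM2l; first exact: sqr_ge0.
rewrite /cut; case: ifP => [yr|_]; last exact: gamma_sym_ge0.
have inr z : Om z -> r k <= inradius (P k z) z.
  move=> Oz; apply: ge_inf; last by exists z.
  by exists 0 => _ [t _ <-]; exact: inradius_ge0.
(* Each of the two polytopes contains the centre of the other, so the average of the truncations is
   the full kernel. *)
rewrite /gamma_sym /gamma_trunc !asboolT.
- by rewrite -[in X in _ <= (_ + X) / _]norm2N opprB; lra.
- have xy : x != y by apply: contra yx => /eqP ->.
  apply: (mem_polytope_inradius (polyP k y) xy).
  by rewrite -norm2N opprB; exact: le_trans yr (inr y Oy).
- exact: (mem_polytope_inradius (polyP k x)) yx (le_trans yr (inr x Ox)).
Qed.
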